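(* Let $K$ be a totally real quartic number field. Then all points in $K$ are preperiodic under iteration of the Mahler measure $M$ if and only if $K$ is biquadratic. In all other cases there are wandering algebraic units in $K$.
   Context: A quartic number field $K$ is biquadratic if $K/\mathbb{Q}$ is Galois with Galois group isomorphic to $C_2\times C_2$, where $C_2$ is the cyclic group of order $2$. Fix an algebraic closure $\overline{\mathbb{Q}}\subseteq\mathbb{C}$ of $\mathbb{Q}$; number fields are subfields of $\overline{\mathbb{Q}}$. For $\alpha\in\overline{\mathbb{Q}}$ with (primitive) minimal polynomial $f(x)=a_nx^n+\cdots+a_0=a_n(x-\alpha_1)\cdots(x-\alpha_n)\in\mathbb{Z}[x]$ (so $f$ is irreducible in $\mathbb{Z}[x]$), the Mahler measure of $\alpha$ is $M(\alpha)=|a_n|\prod_{i=1}^n\max\{1,|\alpha_i|\}$. This is again an algebraic number, so $M$ is a map $\overline{\mathbb{Q}}\to\overline{\mathbb{Q}}$. Put $M^0(\alpha)=\alpha$ and $M^n(\alpha)=M(M^{n-1}(\alpha))$ for $n\ge1$. The point $\alpha$ is preperiodic (under iteration of $M$) if its forward orbit $\{M^n(\alpha):n\ge0\}$ is finite, and wandering if this orbit is infinite. An algebraic unit in $K$ is a unit of the ring of integers of $K$. *)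

(* Defs.v *)
From mathcomp Require Import all_boot all_order all_fingroup all_algebra.
From mathcomp Require Import all_solvable all_field.
From mathcomp Require Import classical_sets cardinality.

Set Implicit Arguments.
Unset Strict Implicit.
Unset Printing Implicit Defensive.

Import Order.TTheory GRing.Theory Num.Theory.
Local Open Scope ring_scope.

(* The primitive integer minimal polynomial of an algebraic number: the monic
   minimal polynomial over rat, cleared of denominators and made primitive.
   zprimitive also makes the leading coefficient positive. *)
Definition minZpoly (a : algC) : {poly int} :=
  zprimitive (projT1 (rat_poly_scale (s2val (minCpolyP a)))).

Lemma minZpoly_neq0 (a : algC) : minZpoly a != 0.
Proof.
rewrite /minZpoly zprimitive_eq0.
case: (minCpolyP a) => p [_ pmon] _ /=.
case: (rat_poly_scale p) => q [c _ Dp] /=.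
apply: contraNneq (monic_neq0 pmon) => q0.
by rewrite Dp q0 rmorph0 scaler0.
Qed.

Lemma minZpoly_primitive (a : algC) : zcontents (minZpoly a) = 1.
Proof.
have := minZpoly_neq0 a; rewrite /minZpoly zprimitive_eq0 => nz.
by rewrite zcontents_primitive nz.
Qed.

Lemma map_minZpoly (a : algC) :
  map_poly intr (minZpoly a) = (lead_coef (minZpoly a))%:~R *: minCpoly a.
Proof.
have nz := minZpoly_neq0 a.
have [c nzc Dm] : exists2 c : algC,
    c != 0 & minCpoly a = c *: map_poly intr (minZpoly a).
  rewrite /minZpoly; move: nz; rewrite /minZpoly zprimitive_eq0.
  case: (minCpolyP a) => p [Dp pmon] _ /=.
  case: (rat_poly_scale p) => q [b nzb Dpq] /= nzq.
  exists (b%:~R^-1 * (zcontents q)%:~R).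
    by rewrite mulf_neq0 ?invr_eq0 ?intr_eq0 ?zcontents_eq0.
  rewrite Dp Dpq map_polyZ fmorphV rmorph_int -scalerA; congr (_ *: _).
  rewrite -map_poly_comp {1}[q]zpolyEprim map_polyZ /=; congr (_ *: _).
    by rewrite ratr_int.
  by apply: eq_map_poly => z /=; rewrite ratr_int.
have := monicP (minCpoly_monic a); rewrite {1}Dm lead_coefZ.
rewrite lead_coef_map_inj //; last exact: intr_inj.
by move=> Dc; rewrite Dm scalerA mulrC Dc scale1r.
Qed.

(* The roots alpha_1, ..., alpha_n of f in algC, with multiplicity. *)
Definition Zpoly_roots (f : {poly int}) : seq algC :=
  sval (closed_field_poly_normal (map_poly intr f)).

(* Num.max is defined on the partial order of algC; both of its arguments here
   are real, hence comparable. *)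
Definition mahler (a : algC) : algC :=
  let f := minZpoly a in
  `|(lead_coef f)%:~R| * \prod_(z <- Zpoly_roots f) Num.max 1 `|z|.

Definition mahler_orbit (a : algC) : set algC :=
  range (fun n => iter n mahler a).

Definition preperiodic (a : algC) : Prop := finite_set (mahler_orbit a).

Definition wandering (a : algC) : Prop := infinite_set (mahler_orbit a).

(* A number field is a subfield K of some normal extension L of rat, embedded
   in algC; L only serves as the ambient type in which galois and 'Gal(K / 1)
   make sense, and imposes no condition on K. *)

(* All embeddings of K alone, not only the restrictions of a fixed embedding of
   L; they have values in algC since K is algebraic over rat. *)
Definition totally_real (L : splittingFieldType rat) (K : {subfield L}) : Prop :=
  forall (sigma : {rmorphism subvs_of K -> algC}) (x : subvs_of K),
    sigma x \is Num.real.

(* 'Z_2 * 'Z_2 carries the additive group structure, so this is C_2 x C_2. *)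
Definition biquadratic (L : splittingFieldType rat) (K : {subfield L}) : Prop :=
  [/\ \dim K = 4%N, galois 1 K
    & ('Gal(K / 1) \isog [set: 'Z_2 * 'Z_2]%SET)%g].

Definition algebraic_unit (L : splittingFieldType rat)
    (iota : {rmorphism L -> algC}) (K : {subfield L}) (u : L) : Prop :=
  [/\ u \in K, iota u \in Aint
    & exists v : L, [/\ v \in K, iota v \in Aint & u * v = 1]].

(* Main.v *)
Require Import Defs.
From mathcomp Require Import all_boot all_order all_fingroup all_algebra.
From mathcomp Require Import all_solvable all_field.
From mathcomp Require Import classical_sets cardinality boolp.
From mathcomp Require Import ring zify.

Set Implicit Arguments.
Unset Strict Implicit.
Unset Printing Implicit Defensive.

Import Order.TTheory GRing.Theory Num.Theory.
Local Open Scope ring_scope.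

(** Write M for the Mahler measure. If u is an algebraic integer with real conjugates
    u_i, then M(u) is, up to sign, the product of the u_i outside the unit disc; call
    these conjugates large. As M depends only on the sign and the conjugacy class of its argument,
    everything is governed by which conjugates are large.

    Biquadratic K. M(x) is always an algebraic integer ([mahler_Aint]), and it lies in
    K because K is normal, so consider an integer x of K with four conjugates.
    If zero, one or all of them are large, M(M(x)) = M(x). If two are large, their
    product is fixed by the involution exchanging them, so M(x) has degree at most
    two and the previous case applies. If three are large, M(x) is N(x) / x up to
    sign and conjugation; a second such step gives N(x)^2 x. This returns to x when
    N(x) is a sign, and otherwise it multiplies every conjugate by at least 4, which
    can happen only finitely often before all conjugates are large
    ([evper_quartic]).

    Other K. The Galois group acts transitively on the four embeddings. If it
    preserves each of the three splittings of the embeddings into two pairs, it acts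
    through the Klein four-group and K is biquadratic ([unsplit_biquadratic]).
    Otherwise the orbit of some pair of embeddings is a regular graph on four
    vertices with two edges at one vertex, hence the complete graph or a 4-cycle
    ([regular_graph4]). In both cases there is a unit x of K with conjugates v_i
    such that, up to sign, M(v_0) = v_0 v_1 and M(v_0 v_1) = v_0^2; all conjugates of
    v_0, and all those of v_0 v_1, have distinct absolute values, so M commutes with
    taking powers of these two numbers, and the orbit of x contains the numbers
    |v_0 v_1|^(2^n) ([wandering_complete], [wandering_cycle], [wandering_pair]).

    Such x come from units whose conjugates have sizes close to t^(w_i) for any
    integer weights w_i of sum zero ([exists_unit]). The box principle
    ([small_linear_forms]) gives points of Z[theta] whose conjugates follow the
    weights, with norm bounded by a constant C; the ratio of two of them that are
    congruent modulo C! is a unit. *)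

(** * Mahler measure and Galois conjugates *)

Lemma galois1f (L : splittingFieldType rat) : galois 1 {:L}.
Proof.
rewrite /galois sub1v normalFieldf andbT /=.
apply/separableP=> y _; apply: pcharf0_separable => p.
by rewrite (pchar_lalg L) Num.Theory.pchar_num.
Qed.

Lemma lead_coef_intr (p : {poly int}) :
  lead_coef (map_poly intr p) = (lead_coef p)%:~R :> algC.
Proof. by rewrite lead_coef_map_inj //; exact: intr_inj. Qed.

Section Conjugates.

Variables (L : splittingFieldType rat) (iota : {rmorphism L -> algC}).
Variable E : {subfield L}.
Hypothesis galE : galois 1 E.

(** Duplicates are removed because an element of smaller degree has a nontrivial
    stabiliser. *)
Definition conjs (x : L) : seq L :=
  undup [seq g x | g : gal_of E <- enum 'Gal(E / 1)%g].

Lemma conjsP x y : reflect (exists2 g, g \in 'Gal(E / 1)%g & y = g x) (y \in conjs x).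
Proof.
rewrite mem_undup; apply: (iffP mapP) => [[g] | [g gG ->]].
  by rewrite mem_enum => gG ->; exists g.
by exists g; rewrite ?mem_enum.
Qed.

Lemma conjs_uniq x : uniq (conjs x).
Proof. exact: undup_uniq. Qed.

Lemma conjs_id x : x \in conjs x.
Proof. by apply/conjsP; exists 1%g; rewrite ?group1 ?gal_id. Qed.

Lemma conjs_mem x y : x \in E -> y \in conjs x -> y \in E.
Proof. by move=> xE /conjsP[g gG ->]; rewrite memv_gal. Qed.

Lemma conjs_perm x y : x \in E -> y \in conjs x -> perm_eq (conjs y) (conjs x).
Proof.
move=> xE /conjsP[g gG ->].
apply: uniq_perm; rewrite ?conjs_uniq // => z; apply/conjsP/conjsP => -[h hG ->].
  by exists (g * h)%g; rewrite ?groupM ?galM.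
by exists (g^-1 * h)%g; rewrite ?groupM ?groupV // -galM // mulKVg.
Qed.

(** An operation that commutes with the Galois group carries orbits to orbits; injectivity
    on the orbit keeps the degree. *)
Lemma conjs_map (f : L -> L) x :
  (forall g : gal_of E, g \in 'Gal(E / 1)%g -> g (f x) = f (g x)) ->
  {in conjs x &, injective f} -> perm_eq (conjs (f x)) (map f (conjs x)).
Proof.
move=> fg finj; apply: uniq_perm; rewrite ?conjs_uniq ?map_inj_in_uniq ?conjs_uniq //.
move=> z; apply/conjsP/mapP => [[g gG ->] | [y /conjsP[g gG ->] ->]].
  by exists (g x); [apply/conjsP; exists g | rewrite fg].
by exists g => //; rewrite fg.
Qed.

Lemma conjsN x : perm_eq (conjs (- x)) (map -%R (conjs x)).
Proof. by apply: conjs_map => [g _|y z _ _]; [rewrite rmorphN | exact: oppr_inj]. Qed.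

Lemma minPoly_conjs x : x \in E -> minPoly 1 x = \prod_(y <- conjs x) ('X - y%:P).
Proof.
move=> xE.
have [r [sr ur Dm]] := galois_factors (sub1v E) galE x xE.
rewrite Dm; apply: perm_big; apply: uniq_perm; rewrite ?conjs_uniq // => y.
rewrite -root_prod_XsubC -Dm; apply/idP/conjsP => [|[g gG ->]].
  rewrite Dm root_prod_XsubC => /mapP[g gr ->]; exists g => //.
  by move/fintype.subsetP: sr; apply.
by rewrite root_minPoly_gal ?sub1v.
Qed.

Lemma size_conjs_dvd x : x \in E -> (size (conjs x) %| \dim E)%N.
Proof.
move=> xE; have /eqP := size_minPoly 1 x.
rewrite minPoly_conjs // size_prod_XsubC eqSS => /eqP ->.
have /field_dimS : (<<1; x>> <= E)%VS by apply/FadjoinP; rewrite sub1v.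
by rewrite dim_Fadjoin dimv1 muln1.
Qed.

Lemma rat_sub1P (x : L) : x \in 1%VS -> exists q : rat, iota x = ratr q.
Proof.
by move/vlineP=> [q ->]; exists q; rewrite rmorphZ_num rmorph1 mulr1.
Qed.

(** Both sides are the monic irreducible polynomial of x over the rationals, seen in
    algC. *)
Lemma minCpoly_iota x : x \in E ->
  minCpoly (iota x) = \prod_(y <- conjs x) ('X - (iota y)%:P).
Proof.
move=> xE.
have [p [Dp pmon] dvp] := minCpolyP (iota x).
have DC (q : {poly rat}) : map_poly iota (map_poly (in_alg L) q) = map_poly ratr q.
  rewrite -map_poly_comp; apply: eq_map_poly => c /=.
  by rewrite rmorphZ_num rmorph1 mulr1.
have [q Dq] : exists q : {poly rat}, minPoly 1 x = map_poly (in_alg L) q.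
  have /polyOver1P := minPolyOver 1 x; case=> q Dq; exists q; exact: Dq.
have Dm : minPoly 1 x = map_poly (in_alg L) p.
  apply/eqP; rewrite -eqp_monic ?monic_minPoly ?map_monic //.
  apply/andP; split.
    apply: minPoly_dvdp; first by apply: alg_polyOver.
    by rewrite -(fmorph_root iota) DC -Dp root_minCpoly.
  rewrite Dq dvdp_map -dvp -DC fmorph_root -Dq; exact: root_minPoly.
rewrite Dp -DC -Dm minPoly_conjs // rmorph_prod.
by apply: eq_bigr => y _; rewrite rmorphB /= map_polyX map_polyC.
Qed.

Lemma mahler_conjs x : x \in E ->
  mahler (iota x) = `|(lead_coef (minZpoly (iota x)))%:~R|
                    * \prod_(y <- conjs x) Num.max 1 `|iota y|.
Proof.
move=> xE; rewrite /mahler; congr (_ * _).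
rewrite /Zpoly_roots; case: closed_field_poly_normal => r /= Dr.
rewrite -(big_map iota xpredT (fun z => Num.max 1 `|z|)); apply: perm_big.
apply: prod_XsubC_eq; rewrite big_map -minCpoly_iota //.
have nz : (lead_coef (minZpoly (iota x)))%:~R != 0 :> algC.
  by rewrite intr_eq0 lead_coef_eq0 minZpoly_neq0.
apply: (scalerI nz); rewrite -map_minZpoly Dr.
by rewrite lead_coef_intr.
Qed.

End Conjugates.

Lemma lead_minZpoly_Aint a : a \in Aint -> `|(lead_coef (minZpoly a))%:~R| = 1 :> algC.
Proof.
move=> aA; have [q Dq qmon] :
    exists2 q : {poly int}, minCpoly a = map_poly intr q & q \is monic.
  have /floorpP[q Dq] : minCpoly a \is a polyOver Num.int by exact: aA.
  exists q => //; have := minCpoly_monic a; rewrite Dq !monicE lead_coef_intr.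
  by rewrite -(eqr_int algC).
have nz := minZpoly_neq0 a; have := minZpoly_primitive a.
have -> : minZpoly a = lead_coef (minZpoly a) *: q.
  apply: (map_inj_poly (intr_inj (R := algC)) (rmorph0 _)).
  by rewrite map_minZpoly map_polyZ Dq.
rewrite zcontentsZ lead_coefZ (monicP qmon) mulr1 zcontents_monic //.
by rewrite mulr1 => ->; exact: normr1.
Qed.

(** * Integrality of the Mahler measure *)

Lemma Aint_integralP (a : algC) : a \in Aint -> integralOver (intr : int -> algC) a.
Proof.
move=> aA; have /floorpP[q Dq] : minCpoly a \is a polyOver Num.int by exact: aA.
exists q; last by rewrite -Dq root_minCpoly.
have := minCpoly_monic a; rewrite Dq !monicE lead_coef_intr.
by rewrite -(eqr_int algC).
Qed.

Lemma root_monic_overAint (p : {poly algC}) (a : algC) :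
  p \is monic -> p \is a polyOver Aint -> root p a -> a \in Aint.
Proof.
move=> pmon pA pa.
have pI : {in p : seq algC, integralRange (intr : int -> algC)}.
  by move=> z /(nthP 0)[i _ <-]; apply: Aint_integralP; apply/polyOverP: i.
have [q qmon qa] := integral_root_monic pmon pa pI.
apply: (root_monic_Aint qa); first by rewrite monic_map.
by apply/polyOverP=> i; rewrite coef_map intr_int.
Qed.

(** With c the leading coefficient and n the degree, c^(n-1) p(X / c) is monic with
    integral coefficients and has the root c a. *)
Lemma lead_root_Aint (p : {poly algC}) (a : algC) :
  p \is a polyOver Aint -> root p a -> lead_coef p * a \in Aint.
Proof.
move=> pA pa; have [->|p0] := eqVneq p 0; first by rewrite lead_coef0 mul0r Aint0.
have c0 : lead_coef p != 0 by rewrite lead_coef_eq0.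
set c := lead_coef p in c0 *; set n := (size p).-1.
have sp : size p = n.+1 by rewrite /n prednK // lt0n size_poly_eq0.
have [n0|n_gt0] := posnP n.
  have Dp : p = (p`_0)%:P by apply: size1_polyC; rewrite sp n0.
  move: pa; rewrite Dp rootC => /eqP p00.
  by move: c0; rewrite /c lead_coefE sp n0 /= p00 eqxx.
pose q := \poly_(i < n.+1) (if i == n then 1 else p`_i * c ^+ (n.-1 - i)).
have qn : q`_n = 1 by rewrite coef_poly ltnSn eqxx.
have sq : size q = n.+1.
  by rewrite /q size_poly_eq //= eqxx oner_neq0.
apply: (@root_monic_overAint q).
- by rewrite monicE lead_coefE sq /= qn.
- apply/polyOverP=> i; rewrite coef_poly; case: ifP => _; last by rewrite rpred0.
  case: ifP => _; first by rewrite rpred1.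
  by rewrite rpredM ?rpredX ?(polyOverP pA) // /c lead_coefE (polyOverP pA).
rewrite /root horner_poly.
suff -> : \sum_(i < n.+1) (if i == n :> nat then 1 else p`_i * c ^+ (n.-1 - i))
     * (c * a) ^+ i = c ^+ n.-1 * p.[a] by rewrite (rootP pa) mulr0.
rewrite horner_coef sp mulr_sumr; apply: eq_bigr => i _.
rewrite exprMn; case: eqP => [->|/eqP ni].
  have -> : p`_n = c by rewrite /c lead_coefE sp.
  by rewrite mul1r [RHS]mulrA -exprSr prednK.
have ltin : (i <= n.-1)%N by rewrite -ltnS prednK // ltn_neqAle ni -ltnS ltn_ord.
by rewrite -{2}(subnK ltin) exprD; ring.
Qed.

(** Dividing out a linear factor keeps the coefficients integral, even when the
    polynomial is not monic: subtracting c X^(n-1) (X - a) lowers the degree,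
    and its coefficients are integral because c a is. *)
Lemma div_XsubC_Aint (q : {poly algC}) (a : algC) :
  q * ('X - a%:P) \is a polyOver Aint -> q \is a polyOver Aint.
Proof.
move: {2}(size q) (leqnn (size q)) => n.
elim: n q => [|n IHn] q sq pA.
  by move: sq; rewrite leqn0 size_poly_eq0 => /eqP->; rewrite rpred0.
have [->|q0] := eqVneq q 0; first by rewrite rpred0.
set c := lead_coef q; set m := (size q).-1.
have Dq : q = (q - c *: 'X^m) + c *: 'X^m by rewrite subrK.
have cA : c \in Aint.
  have <- : lead_coef (q * ('X - a%:P)) = c by rewrite lead_coefM lead_coefXsubC mulr1.
  by rewrite lead_coefE (polyOverP pA).
have caA : c * a \in Aint.
  have <- : lead_coef (q * ('X - a%:P)) = c by rewrite lead_coefM lead_coefXsubC mulr1.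
  by apply: lead_root_Aint => //; rewrite rootM root_XsubC eqxx orbT.
have cX : c *: 'X^m \is a polyOver Aint by rewrite polyOverZ ?polyOverXn.
rewrite Dq rpredD // IHn //.
  apply/leq_sizeP=> j le_nj; rewrite coefB coefZ coefXn.
  have [->|nejm] := eqVneq j m; first by rewrite mulr1 /c lead_coefE subrr.
  rewrite mulr0 subr0 nth_default //.
  move: sq le_nj nejm; rewrite /m; case: (size q) => [|k] //=.
  rewrite ltnS => /leq_trans le /le; rewrite leq_eqVlt eq_sym.
  by case/predU1P=> [->|//]; rewrite eqxx.
have -> : (q - c *: 'X^m) * ('X - a%:P)
        = q * ('X - a%:P) - (c *: 'X^(m.+1) - (c * a) *: 'X^m).
  rewrite mulrBl; congr (_ - _); rewrite -scalerAl mulrBr -exprSr [_ * a%:P]mulrC mul_polyC.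
  by rewrite scalerBr scalerA.
by rewrite rpredB // rpredB // polyOverZ ?polyOverXn.
Qed.

(** The square of |a| is a times its complex conjugate. *)
Lemma norm_Aint (a : algC) : a \in Aint -> `|a| \in Aint.
Proof.
move=> aA; have : `|a| ^+ 2 \in Aint.
  by rewrite normCK rpredM // (Aint_aut (Num.conj)).
move=> sA; apply: (@root_monic_overAint ('X^2 - (`|a| ^+ 2)%:P)).
- by rewrite monicXnsubC.
- by rewrite rpredB ?polyOverXn ?polyOverC.
- by rewrite rootE !hornerE subrr.
Qed.

(** Removing from an integral polynomial the linear factors of the roots to be
    discarded leaves an integral polynomial, whose constant coefficient is, up to
    sign, c times the product of the roots that are kept. *)
Lemma prod_filter_Aint (c : algC) (r : seq algC) (P : pred algC) :
  c *: \prod_(z <- r) ('X - z%:P) \is a polyOver Aint ->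
  c * \prod_(z <- r | P z) z \in Aint.
Proof.
(* s collects the roots that have been examined and kept *)
suff H (s : seq algC) : c *: (\prod_(z <- r) ('X - z%:P) * \prod_(z <- s) ('X - z%:P))
     \is a polyOver Aint -> c * \prod_(z <- r | P z) z * \prod_(z <- s) z \in Aint.
  by move=> cA; have := H [::]; rewrite !big_nil !mulr1; apply.
elim: r s => [|z r IHr] s.
  rewrite !big_nil mul1r mulr1 => /polyOverP/(_ 0%N).
  rewrite coefZ coef0_prod (eq_bigr (fun z => - z)) => [|z _]; last first.
    by rewrite coefB coefX coefC sub0r.
  rewrite (eq_bigr (fun z => -1 * z)) => [|z _]; last by rewrite mulN1r.
  rewrite big_split /= big_const_seq iter_mulr_1 mulrCA.
  by move/(rpredM (rpredX (count xpredT s) (rpredN1 Aint))) ; rewrite signrMK.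
rewrite big_cons [in X in _ -> X]big_cons => cA.
case: (P z); last first.
  apply: IHr; apply: (@div_XsubC_Aint _ z); apply: etrans cA.
  rewrite -scalerAl; congr (_ \is a _); congr (_ *: _);
    by rewrite [RHS]mulrC mulrA [RHS]mulrC mulrA.
have := IHr (z :: s); rewrite !big_cons.
have -> : c * (z * \prod_(j <- r | P j) j) * \prod_(j <- s) j
        = c * \prod_(j <- r | P j) j * (z * \prod_(j <- s) j) by ring.
by apply; apply: etrans cA; congr (_ \is a _); congr (_ *: _); rewrite mulrCA mulrA.
Qed.

Lemma mahlerE a : mahler a = `|(lead_coef (minZpoly a))%:~R
    * \prod_(z <- Zpoly_roots (minZpoly a) | 1 < `|z|) z|.
Proof.
rewrite /mahler normrM normr_prod big_mkcond /=; congr (_ * _).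
rewrite [RHS]big_mkcond /=; apply: eq_bigr => z _.
by rewrite /Order.max; case: ifP.
Qed.

Lemma mahler_Aint a : mahler a \in Aint.
Proof.
rewrite mahlerE; apply: norm_Aint; apply: prod_filter_Aint.
rewrite /Zpoly_roots; case: closed_field_poly_normal => r /= Dr.
rewrite -lead_coef_intr -Dr; apply/polyOverP=> i.
by rewrite coef_map Aint_int.
Qed.

(** * Preperiodicity over a biquadratic field *)

Section IntegralConjugates.

Variables (L : splittingFieldType rat) (iota : {rmorphism L -> algC}).
Variable E : {subfield L}.
Hypothesis galE : galois 1 E.

Local Notation conjs := (conjs E).

Lemma conjs_Aint x y : x \in E -> iota x \in Aint -> y \in conjs x -> iota y \in Aint.
Proof.
move=> xE xA yx; have yE := conjs_mem xE yx.
suff Dm : minCpoly (iota y) = minCpoly (iota x) by rewrite /Aint unfold_in Dm.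
by rewrite !(minCpoly_iota iota galE) //; apply: perm_big; exact: conjs_perm.
Qed.

Definition outside (x : L) : seq L := [seq y <- conjs x | 1 < `|iota y|].

Lemma mahler_outside x : x \in E -> iota x \in Aint ->
  mahler (iota x) = `|iota (\prod_(y <- outside x) y)|.
Proof.
move=> xE xA; rewrite (mahler_conjs iota galE) // lead_minZpoly_Aint // mul1r.
rewrite big_filter rmorph_prod normr_prod [RHS]big_mkcond /=.
by apply: eq_bigr => z _; rewrite /Order.max; case: ifP.
Qed.

Lemma mahler_conj x y : x \in E -> iota x \in Aint -> y \in conjs x ->
  mahler (iota y) = mahler (iota x).
Proof.
move=> xE xA yx; have yE := conjs_mem xE yx; have yA := conjs_Aint xE xA yx.
rewrite !(mahler_conjs iota galE) // !lead_minZpoly_Aint //; congr (_ * _).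
exact/perm_big/conjs_perm.
Qed.

Lemma mahlerN x : x \in E -> iota x \in Aint -> mahler (iota (- x)) = mahler (iota x).
Proof.
move=> xE xA; rewrite !(mahler_conjs iota galE) ?rpredN // ?lead_minZpoly_Aint //.
  congr (_ * _); rewrite (perm_big _ (conjsN E x)) big_map.
  by apply: eq_bigr => y _; rewrite rmorphN normrN.
by rewrite rmorphN rpredN.
Qed.

Lemma mahler_norm x : x \in E -> iota x \in Aint -> iota x \is Num.real ->
  mahler `|iota x| = mahler (iota x).
Proof.
move=> xE xA xR; have [_|_] := real_ge0P xR; first by [].
by rewrite -rmorphN mahlerN.
Qed.

End IntegralConjugates.

(** Preperiodicity as the existence of one repetition, which is the form in which it
    is transported along the dynamics. *)
Definition eventually_periodic (z : algC) :=
  exists i p, iter (i + p.+1) mahler z = iter i mahler z.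

Lemma evper_preperiodic z : eventually_periodic z -> preperiodic z.
Proof.
case=> i [p per].
have : (mahler_orbit z `<=`
        [set` [seq iter n mahler z | n <- iota 0 (i + p.+1)]])%classic.
  move=> _ [n _ <-] /=.
  elim/ltn_ind: n => n IHn.
  have [lt_n|le_n] := ltnP n (i + p.+1)%N.
    by apply/mapP; exists n; rewrite ?mem_iota.
  rewrite -(subnK le_n) iterD per -iterD.
  by apply: IHn; lia.
by move/sub_finite_set; apply; apply: finite_seq.
Qed.

Lemma evper_mahler z : eventually_periodic (mahler z) <-> eventually_periodic z.
Proof.
split=> -[i [p per]].
  by exists i.+1, p; rewrite addSn !iterSr.
exists i, p; rewrite -!iterSr !iterS; congr (mahler _); exact: per.
Qed.

Lemma evper_eq z y : mahler z = mahler y -> eventually_periodic y ->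
  eventually_periodic z.
Proof. by move=> Dz /evper_mahler; rewrite -Dz evper_mahler. Qed.

Lemma evper_fix z : mahler (mahler z) = mahler z -> eventually_periodic z.
Proof. by move=> fz; exists 1%N, 0%N. Qed.

Lemma evper_fix3 z : mahler (mahler (mahler z)) = mahler z -> eventually_periodic z.
Proof. by move=> fz; exists 1%N, 1%N. Qed.

Section Biquadratic.

Variables (L : splittingFieldType rat) (iota : {rmorphism L -> algC}).
Variable E : {subfield L}.
Hypothesis galE : galois 1 E.

Local Notation conjs := (conjs E).
Local Notation outside := (outside iota E).
Local Notation Gal1 := 'Gal(E / 1)%g.

Lemma prod_conjs_fixed x g : x \in E -> g \in Gal1 ->
  g (\prod_(y <- conjs x) y) = \prod_(y <- conjs x) y.
Proof.
move=> xE gG; rewrite rmorph_prod -(big_map g xpredT id).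
apply: perm_big; apply: uniq_perm; rewrite ?map_inj_uniq ?conjs_uniq //.
  exact: fmorph_inj.
move=> z; apply/mapP/conjsP => [[y /conjsP[h hG ->] ->] | [h hG ->]].
  by exists (h * g)%g; rewrite ?groupM ?galM.
exists ((h * g^-1)%g x); first by apply/conjsP; exists (h * g^-1)%g; rewrite ?groupM ?groupV.
by rewrite -galM // mulgKV.
Qed.

Lemma prod_mem (r : seq L) : {subset r <= E} -> \prod_(y <- r) y \in E.
Proof.
by move=> rE; rewrite big_seq; apply: rpred_prod => y /rE.
Qed.

Lemma prod_Aint (r : seq L) : {in r, forall y, iota y \in Aint} ->
  iota (\prod_(y <- r) y) \in Aint.
Proof.
by move=> rA; rewrite big_seq rmorph_prod; apply: rpred_prod => y /rA.
Qed.

Lemma fixed_int c : c \in E -> iota c \in Aint ->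
  (forall g, g \in Gal1 -> g c = c) -> iota c \is a Num.int.
Proof.
move=> cE cA fc; apply: Cint_rat_Aint => //.
have /(rat_sub1P iota)[q ->] : c \in 1%VS; last exact: Crat_rat.
have /galois_fixedField <- := galE.
exact/fixedFieldP.
Qed.

Lemma fixed_conjs c : (forall g, g \in Gal1 -> g c = c) -> perm_eq (conjs c) [:: c].
Proof.
move=> fc; apply: uniq_perm; rewrite ?conjs_uniq // => y; rewrite inE.
apply/conjsP/eqP => [[g gG ->] | ->]; first exact: fc.
by exists 1%g; rewrite ?group1 ?gal_id.
Qed.

Lemma fixed_mahler c : c \in E -> iota c \in Aint ->
  (forall g, g \in Gal1 -> g c = c) -> mahler (iota c) = Num.max 1 `|iota c|.
Proof.
move=> cE cA fc; rewrite (mahler_conjs iota galE) // lead_minZpoly_Aint // mul1r.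
by rewrite (perm_big _ (fixed_conjs fc)) big_seq1.
Qed.

Hypothesis realE : {in E, forall x, iota x \is Num.real}.

(** The Mahler measure is then 1, a conjugate of x up to sign, or the absolute value of
    the product of the conjugates of x, and each of these is its own Mahler measure. *)
Lemma evper_outside x : x \in E -> iota x \in Aint ->
  size (outside x) \in [:: 0; 1; size (conjs x)]%N -> eventually_periodic (iota x).
Proof.
move=> xE xA; rewrite !inE => /or3P[] /eqP szo.
- apply: evper_fix; rewrite (mahler_outside galE) // (size0nil szo) big_nil rmorph1 normr1.
  rewrite -(rmorph1 iota) fixed_mahler ?rmorph1 ?mem1v ?normr1 ?rpred1 //.
    by rewrite /Order.max ltxx.
  by move=> g _; rewrite rmorph1.
- apply: evper_fix; have [y Dy] : exists y, outside x = [:: y].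
    by case: (outside x) szo => [|y []] // _; exists y.
  have yx : y \in conjs x.
    have : y \in outside x by rewrite Dy inE.
    by rewrite mem_filter => /andP[].
  have yE := conjs_mem xE yx; have yA := conjs_Aint galE xE xA yx.
  rewrite (mahler_outside galE xE xA) Dy big_seq1 (mahler_norm galE) ?realE //.
  by rewrite (mahler_conj galE xE xA yx) (mahler_outside galE xE xA) Dy big_seq1.
have Do : outside x = conjs x.
  apply/all_filterP; rewrite all_count -szo size_filter; apply/eqP.
  by rewrite size_filter in szo.
set c := \prod_(y <- conjs x) y.
have cE : c \in E by apply: prod_mem => y; apply: conjs_mem.
have cA : iota c \in Aint by apply: prod_Aint => y; apply: conjs_Aint.
have cf g : g \in Gal1 -> g c = c by apply: prod_conjs_fixed.
have c1 : 1 <= `|iota c|.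
  rewrite /c rmorph_prod normr_prod big_seq.
  apply: (big_ind (fun z => 1 <= z)) => // [z t z1 t1|y]; first exact: mulr_ege1.
  by rewrite -Do mem_filter => /andP[/ltW].
apply: evper_fix; rewrite (mahler_outside galE xE xA) Do -/c (mahler_norm galE) ?realE //.
by rewrite fixed_mahler //; apply/max_idPr.
Qed.

Lemma evper_size2 x : x \in E -> iota x \in Aint -> (size (conjs x) <= 2)%N ->
  eventually_periodic (iota x).
Proof.
move=> xE xA sz; apply: evper_outside => //; rewrite !inE.
have : (size (outside x) <= size (conjs x))%N by rewrite size_filter count_size.
have : (0 < size (conjs x))%N by case: (conjs x) (conjs_id E x).
by move: sz; case: (size (conjs x)) => [|[|[|]]] //; case: (size (outside x)) => [|[|[|]]].
Qed.

Hypothesis dimE : \dim E = 4%N.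
Hypothesis involE : forall g, g \in Gal1 -> {in E, forall x, g (g x) = x}.

Lemma card_Gal1 : #|Gal1| = 4%N.
Proof. by rewrite -(galois_dim galE) dimv1 divn1. Qed.

(** A product of two conjugates is fixed by the involution exchanging them, so its
    degree is at most two. *)
Lemma size_conjs_swap x y1 y2 : x \in E -> y1 \in conjs x -> y2 \in conjs x -> y1 != y2 ->
  (size (conjs (y1 * y2)) <= 2)%N.
Proof.
move=> xE /conjsP[a aG Dy1] /conjsP[b bG Dy2] ny.
have y1E : y1 \in E by rewrite Dy1 memv_gal.
have y2E : y2 \in E by rewrite Dy2 memv_gal.
have zE : y1 * y2 \in E by rewrite rpredM.
have := size_conjs_dvd galE zE; rewrite dimE.
suff : (size (conjs (y1 * y2)) < 4)%N by move: (size _) => [|[|[|[|]]]].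
rewrite ltnNge; apply/negP => sz.
have /dinjectiveP inj_z : dinjectiveb (fun g : gal_of E => g (y1 * y2)) Gal1.
  by rewrite -[dinjectiveb _ _]negbK -ltn_size_undup size_map -cardE card_Gal1 -leqNgt.
have hG : (a^-1 * b)%g \in Gal1 by rewrite groupM ?groupV.
have h1 : (a^-1 * b)%g y1 = y2 by rewrite Dy1 -galM // mulKVg.
have h2 : (a^-1 * b)%g y2 = y1 by rewrite -h1 involE.
have /inj_z h1G : (a^-1 * b)%g (y1 * y2) = (1 : gal_of E)%g (y1 * y2).
  by rewrite gal_id rmorphM /= h1 h2 mulrC.
by case/eqP: ny; rewrite -h1 h1G ?group1 // gal_id.
Qed.

(** If z is the conjugate in the unit disc, the product of the three others is c / z,
    which is conjugate to c / x. *)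
Lemma mahler_outside3 x : x \in E -> iota x \in Aint -> size (conjs x) = 4%N ->
  size (outside x) = 3%N -> let c := \prod_(y <- conjs x) y in
  [/\ x != 0, iota (c / x) \in Aint, mahler (mahler (iota x)) = mahler (iota (c / x)),
      perm_eq (conjs (c / x)) [seq c / y | y <- conjs x]
    & \prod_(y <- conjs (c / x)) y = c ^+ 3].
Proof.
move=> xE xA sz4 sz3 c.
have x0 : x != 0.
  apply/negP=> /eqP x0; have [y yo] : exists y, y \in outside x.
    by case: (outside x) sz3 => // y s _; exists y; rewrite inE eqxx.
  move: yo; rewrite mem_filter => /andP[y1 /conjsP[g gG Dy]].
  by move: y1; rewrite Dy x0 !rmorph0 normr0 ltr10.
have y0 y : y \in conjs x -> y != 0 by case/conjsP=> g _ ->; rewrite fmorph_eq0.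
have cE : c \in E by apply: prod_mem => y; apply: conjs_mem.
have cA : iota c \in Aint by apply: prod_Aint => y; apply: conjs_Aint.
have cf g : g \in Gal1 -> g c = c by apply: prod_conjs_fixed.
have c0 : c != 0.
  by rewrite /c big_seq prodf_seq_neq0; apply/allP => y _; apply/implyP; exact: y0.
have Dcx : perm_eq (conjs (c / x)) [seq c / y | y <- conjs x].
  apply: (@conjs_map _ _ (fun y => c / y)) => [g gG|y z _ _ /(mulfI c0) /invr_inj //].
  by rewrite fmorph_div /= cf.
have [z zx Do] : exists2 z, z \in conjs x & perm_eq (conjs x) (z :: outside x).
  set r := [seq y <- conjs x | predC (fun y => 1 < `|iota y|) y].
  have Dr : perm_eq (outside x ++ r) (conjs x) by rewrite perm_filterC.
  have : size r = 1%N.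
    by have := perm_size Dr; rewrite size_cat sz3 sz4 => -[].
  case: r Dr => [|z [|]] // Dr _; exists z.
    by rewrite -(perm_mem Dr) mem_cat inE eqxx orbT.
  by rewrite perm_sym -cat1s perm_catC.
have zE : z \in E := conjs_mem xE zx.
have Dpo : \prod_(y <- outside x) y = c / z.
  by rewrite /c (perm_big _ Do) big_cons /= mulrC mulKf ?y0.
have poA : iota (c / z) \in Aint.
  rewrite -Dpo; apply: prod_Aint => y; rewrite mem_filter => /andP[_].
  exact: conjs_Aint.
have zcx : c / z \in conjs (c / x).
  by rewrite (perm_mem Dcx); apply/mapP; exists z.
have cxz : c / x \in conjs (c / z).
  have zcE : c / z \in E by rewrite rpred_div.
  have cxE : c / x \in E by rewrite rpred_div.
  by rewrite (perm_mem (conjs_perm cxE zcx)) conjs_id.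
have czE : c / z \in E by rewrite rpred_div.
split => //.
- exact: (conjs_Aint galE czE poA cxz).
- rewrite (mahler_outside galE xE xA) Dpo (mahler_norm galE) ?realE //.
  by rewrite -(mahler_conj galE czE poA cxz).
rewrite (perm_big _ Dcx) big_map big_split /= prodfV -/c big_const_seq.
by rewrite count_predT sz4 iter_mulr_1 exprSr mulfK.
Qed.

(** Induction on a bound k for the number of pairs of steps after which all conjugates
    are large: two consecutive steps with three large conjugates turn x into c^2 x,
    where c is its norm, and c^2 is 1 or at least 4. *)
Lemma evper_quartic k x : x \in E -> iota x \in Aint -> size (conjs x) = 4%N ->
  (forall y, y \in conjs x -> 1 < 4%:R ^+ k * `|iota y|) -> eventually_periodic (iota x).
Proof.
elim: k x => [|k IHk] x xE xA sz4 xbig.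
  apply: evper_outside => //; rewrite !inE; apply/or3P/Or33.
  by rewrite size_filter -all_count; apply/allP => y /xbig; rewrite mul1r.
(* every case but three large conjugates ends within a bounded number of steps *)
have done x' : x' \in E -> iota x' \in Aint -> size (conjs x') = 4%N ->
    size (outside x') != 3%N -> eventually_periodic (iota x').
  move=> x'E x'A sz' ne3.
  have : (size (outside x') <= 4)%N by rewrite -sz' size_filter count_size.
  case Ds: (size (outside x')) ne3 => [|[|[|[|[|]]]]] // _ _.
  - by apply: evper_outside; rewrite // Ds.
  - by apply: evper_outside; rewrite // Ds.
  - apply: (evper_mahler _).1; rewrite (mahler_outside galE) //.
    have [y1 [y2 Dy]] : exists y1 y2, outside x' = [:: y1; y2].
      by case: (outside x') Ds => [|y1 [|y2 []]] // _; exists y1, y2.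
    have uo : uniq (outside x') by rewrite filter_uniq ?conjs_uniq.
    have yo y : y \in outside x' -> y \in conjs x' by rewrite mem_filter => /andP[].
    have y1o : y1 \in conjs x' by rewrite yo // Dy inE eqxx.
    have y2o : y2 \in conjs x' by rewrite yo // Dy !inE eqxx orbT.
    have y1E := conjs_mem x'E y1o; have y2E := conjs_mem x'E y2o.
    have yA : iota (y1 * y2) \in Aint.
      by rewrite rmorphM rpredM ?(conjs_Aint galE x'E x'A).
    have yE : y1 * y2 \in E by rewrite rpredM.
    rewrite Dy big_cons big_seq1; apply: evper_eq (mahler_norm galE yE yA (realE yE)) _.
    apply: evper_size2 => //; apply: size_conjs_swap y1o y2o _ => //.
    by move: uo; rewrite Dy /= inE andbT.
  - by apply: evper_outside; rewrite // Ds sz'.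
have [sz3|] := eqVneq (size (outside x)) 3%N; last exact: done.
have [x0 dA Mx Dcj Dd] := mahler_outside3 xE xA sz4 sz3.
set c := \prod_(y <- conjs x) y in dA Mx Dcj Dd; set d := c / x in dA Mx Dcj Dd.
have cE : c \in E by apply: prod_mem => y; apply: conjs_mem.
have dE : d \in E by rewrite rpred_div.
have cA : iota c \in Aint by apply: prod_Aint => y; apply: conjs_Aint.
have cf g : g \in Gal1 -> g c = c by apply: prod_conjs_fixed.
have szd : size (conjs d) = 4%N by rewrite (perm_size Dcj) size_map.
do 2!apply: (evper_mahler _).1; rewrite Mx; apply: (evper_mahler _).2.
have [szd3|] := eqVneq (size (outside d)) 3%N; last exact: done.
have [d0 eA Md _ _] := mahler_outside3 dE dA szd szd3.
have c0 : c != 0 by apply: contraNneq d0 => c0; rewrite /d c0 mul0r.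
rewrite Dd in eA Md.
have De : c ^+ 3 / d = c ^+ 2 * x.
  by rewrite /d invf_div exprSr -mulrA [c * _]mulrC divfK.
rewrite De in eA Md.
have cx : perm_eq (conjs (c ^+ 2 * x)) [seq c ^+ 2 * y | y <- conjs x].
  apply: conjs_map => [g gG|]; first by rewrite rmorphM rmorphXn /= cf.
  by move=> y z _ _; apply: mulfI; rewrite expf_neq0.
have ceE : c ^+ 2 * x \in E by rewrite rpredM ?rpredX.
have := fixed_int cE cA cf => /intrP[n Dn].
have [n1|n1] := eqVneq `|iota c| 1.
  have c21 : c ^+ 2 = 1.
    apply: (fmorph_inj iota); rewrite rmorph1 rmorphXn /=.
    by rewrite -real_normK ?realE // n1 expr1n.
  rewrite c21 mul1r in Md.
  by apply: evper_fix3; rewrite Md Mx.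
do 2!apply: (evper_mahler _).1; rewrite Md; apply: (evper_mahler _).2.
apply: IHk => //; first by rewrite (perm_size cx) size_map.
move=> y; rewrite (perm_mem cx) => /mapP[z zx ->].
rewrite rmorphM rmorphXn normrM normrX mulrA.
apply: lt_le_trans (xbig z zx) _; rewrite ler_wpM2r //.
rewrite [leLHS]exprSr ler_wpM2l ?exprn_ge0 //.
have : 2 <= `|iota c|.
  have Dnn : `|iota c| = (absz n)%:R by rewrite Dn natr_absz intr_norm.
  move: n1 c0; rewrite -(fmorph_eq0 iota) -normr_eq0 Dnn pnatr_eq1 pnatr_eq0 ler_nat.
  by case: (absz n) => [|[]].
by move=> c2; rewrite (natrX _ 2 2) lerXn2r ?nnegrE.
Qed.

Lemma exp4_gt (r : seq algC) : {in r, forall z, 0 < z} ->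
  exists k, {in r, forall z, 1 < 4%:R ^+ k * z}.
Proof.
elim: r => [|z r IHr] r0; first by exists 0%N.
have [|k kr] := IHr; first by move=> t tr; rewrite r0 // inE tr orbT.
have z0 : 0 < z by rewrite r0 // inE eqxx.
pose n := Num.bound z^-1; exists (k + n)%N => t; rewrite inE exprD => /predU1P[->|tr].
  rewrite -ltr_pdivrMr // div1r.
  apply: lt_le_trans (archi_boundP _) _; first by rewrite invr_ge0 ltW.
  rewrite -!natrX -natrM ler_nat (leq_trans (ltnW (ltn_expl n (isT : 1 < 4)%N))) //.
  by rewrite leq_pmull ?expn_gt0.
apply: lt_le_trans (kr t tr) _; rewrite ler_pM2r; last by rewrite r0 // inE tr orbT.
by rewrite ler_peMr ?exprn_ge0 // exprn_ege1 // ler1n.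
Qed.

Lemma evper_Aint x : x \in E -> iota x \in Aint -> eventually_periodic (iota x).
Proof.
move=> xE xA; have := size_conjs_dvd galE xE; rewrite dimE.
case: (leqP (size (conjs x)) 2) => [le2 _|le3 dv4]; first exact: evper_size2.
have sz4 : size (conjs x) = 4%N.
  by have := dvdn_leq (isT : 0 < 4)%N dv4; move: dv4 le3; case: (size _) => [|[|[|[|[|]]]]].
have [|k kx] := @exp4_gt [seq `|iota y| | y <- conjs x].
  move=> _ /mapP[y yx ->]; rewrite normr_gt0 fmorph_eq0.
  apply: contraTneq yx => -> ; apply/negP => /conjsP[g gG].
  move/esym/eqP; rewrite fmorph_eq0 => /eqP x0; move: sz4.
  by rewrite (perm_size (fixed_conjs _)) // => h _; rewrite x0 rmorph0.
by apply: (@evper_quartic k) => // y yx; apply: kx; apply: map_f.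
Qed.

(** Since E is normal and totally real, each factor max(1, |y|) is 1 or a conjugate of x
    up to sign. *)
Lemma mahler_rational x : x \in E -> exists2 y, y \in E & mahler (iota x) = iota y.
Proof.
move=> xE; rewrite (mahler_conjs iota galE) //.
have norm_E z : z \in E -> exists2 y, y \in E & `|iota z| = iota y.
  move=> zE; have [_|_] := real_ge0P (realE zE); first by exists z.
  by exists (- z); rewrite ?rpredN ?rmorphN.
rewrite -intr_norm; move: (Num.norm (lead_coef _)) => a.
have aE : a%:~R \in E by rewrite rpred_int.
have : forall r : seq L, {subset r <= E} -> exists2 y, y \in E &
    \prod_(z <- r) Num.max 1 `|iota z| = iota y.
  elim=> [|z r IHr] rE; first by exists 1; rewrite ?mem1v // big_nil rmorph1.
  have [|y yE Dy] := IHr; first by move=> t tr; rewrite rE // inE tr orbT.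
  rewrite big_cons Dy /Order.max; case: ifP => _; last by exists y; rewrite ?mul1r.
  have [|t tE ->] := norm_E z; first by rewrite rE // inE eqxx.
  by exists (t * y); rewrite ?rpredM ?rmorphM.
case/(_ (conjs x)) => [z|y yE ->]; first exact: conjs_mem.
by exists (a%:~R * y); rewrite ?rpredM // rmorphM rmorph_int.
Qed.

Lemma preperiodic_biquadratic x : x \in E -> preperiodic (iota x).
Proof.
move=> xE; apply: evper_preperiodic; apply: (evper_mahler _).1.
have yA := mahler_Aint (iota x); have [y yE Dy] := mahler_rational xE.
by rewrite Dy in yA *; apply: evper_Aint.
Qed.

End Biquadratic.

Lemma klein_abelem :
  (2.-abelem [set: 'Z_2 * 'Z_2])%g /\ #|[set: 'Z_2 * 'Z_2]%SET| = 4%N.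
Proof.
split; last by rewrite cardsT card_prod card_ord.
apply/abelemP => //; split=> [|x _].
  by apply/centsP => x _ y _; exact: (@addrC _ x y).
case: x => -[m lt_m] [n lt_n]; apply/eqP.
by case: m lt_m => [|[|]] // ?; case: n lt_n => [|[|]].
Qed.

Lemma biquadratic_preperiodic (L : splittingFieldType rat)
    (iota : {rmorphism L -> algC}) (K : {subfield L}) :
  totally_real K -> biquadratic K -> forall x, x \in K -> preperiodic (iota x).
Proof.
move=> realK [dimK galK isoK] x xK; apply: (@preperiodic_biquadratic _ _ K) => //.
  by move=> y yK; have := realK (iota \o @vsval _ _ K) (Subvs yK).
have [ab _] := klein_abelem; move: isoK; rewrite isog_sym (isog_abelem_card _ ab).
case/andP=> /abelemP[//|_ exK] _ g gG y yK.
by rewrite -galM // -expg2 exK // gal_id.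
Qed.

(** * Units with prescribed sizes *)

(** Dirichlet's box principle for linear forms. The integer points of the cube
    [0, N]^n outnumber the boxes of a grid with m i steps in direction i, so two of
    them fall in one box. *)
Lemma small_linear_forms (n : nat) (A : 'I_n -> 'I_n -> algC) :
  (0 < n)%N -> (forall i k, A i k \is Num.real) ->
  exists2 D : nat, (1 < D)%N & forall (N : nat) (m : 'I_n -> nat),
    (0 < N)%N -> (forall i, 0 < m i)%N -> (\prod_i m i < N.+1 ^ n)%N ->
    exists2 z : 'I_n -> int, exists k, z k != 0 &
      forall i, `|\sum_k A i k * (z k)%:~R| * (m i)%:R <= D%:R * N%:R.
Proof.
move=> n_gt0 Areal.
(* Every form is bounded by B N on the cube. Boxes of width (2B + 2) N / m i, slightly
   more than 2 B N / m i, keep the endpoint B N inside the last box. *)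
pose B := (\sum_i \sum_k Num.bound `|A i k|)%N.
have boundA i k : `|A i k| <= (Num.bound `|A i k|)%:R.
  by rewrite ltW // archi_boundP.
have rowA i : \sum_k `|A i k| <= B%:R.
  apply: le_trans (ler_sum _ (fun k _ => boundA i k)) _.
  by rewrite -natr_sum ler_nat /B [leqRHS](bigD1 i) //= leq_addr.
exists (2 * B).+2 => // N m N_gt0 m_gt0 lt_m.
set D := (2 * B).+2.
pose f (z : {ffun 'I_n -> 'I_N.+1}) i : algC := \sum_k A i k * (z k : nat)%:R.
have f_real z i : f z i \is Num.real by apply: rpred_sum => k _; rewrite rpredM ?realn.
have f_bound z i : `|f z i| <= B%:R * N%:R.
  apply: le_trans (ler_norm_sum _ _ _) _.
  apply: le_trans (_ : (\sum_k `|A i k|) * N%:R <= _); last by rewrite ler_wpM2r ?ler0n.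
  rewrite mulr_suml; apply: ler_sum => k _; rewrite normrM normr_nat ler_wpM2l //.
  by rewrite ler_nat -ltnS.
pose h z i : algC := (f z i + B%:R * N%:R) * (m i)%:R / (D%:R * N%:R).
have DN0 : 0 < D%:R * N%:R :> algC by rewrite -natrM ltr0n muln_gt0.
have h0 z i : 0 <= h z i.
  rewrite divr_ge0 ?mulr_ge0 ?ler0n //.
  by have := f_bound z i; rewrite real_ler_norml // -lerBlDr sub0r => /andP[].
have lt_h z i : (Num.trunc (h z i) < m i)%N.
  have /andP[le _] := trunc_itv (h0 z i).
  rewrite -(ltr_nat algC); apply: le_lt_trans le _.
  rewrite ltr_pdivrMr // [ltRHS]mulrC ltr_pM2r ?ltr0n //.
  have : f z i <= B%:R * N%:R by have := f_bound z i; rewrite real_ler_norml // => /andP[].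
  move=> f_le; apply: le_lt_trans (lerD f_le (lexx _)) _.
  by rewrite -mulrDl ltr_pM2r ?ltr0n // -natrD ltr_nat /D; lia.
pose F z : {dffun forall i, 'I_(m i)} := [ffun i => Ordinal (lt_h z i)].
have /injectivePn[z [z' nzz' FF]] : ~~ injectiveb F.
  apply/negP=> /injectiveP /leq_card; apply/negP; rewrite -ltnNge.
  rewrite card_dep_ffun card_ffun !card_ord foldrE big_map big_enum /=.
  by rewrite (eq_bigr m) // => i _; rewrite card_ord.
exists (fun k => (z k : int) - (z' k : int)).
  have /existsP[k nk] : [exists k, z k != z' k].
    apply: contraR nzz'; rewrite negb_exists => /forallP eqz.
    by apply/eqP/ffunP => k; apply/eqP; have := eqz k; rewrite negbK.
  by exists k; rewrite subr_eq0; apply: contraNneq nk => -[] /val_inj ->.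
move=> i.
rewrite (eq_bigr (fun k => A i k * (z k : nat)%:R - A i k * (z' k : nat)%:R)); last first.
  by move=> k _; rewrite rmorphB mulrBr.
rewrite sumrB -/(f z i) -/(f z' i).
have Dh : f z i - f z' i = (h z i - h z' i) * (D%:R * N%:R) / (m i)%:R.
  rewrite /h -mulrBl divfK ?gt_eqF // -mulrBl mulfK ?pnatr_eq0 -?lt0n //.
  by rewrite opprD addrACA subrr addr0.
rewrite Dh normrM normfV normr_nat divfK ?pnatr_eq0 -?lt0n //.
rewrite normrM (ger0_norm (ltW DN0)) ler_piMl ?ltW //.
have /ffunP/(_ i) := FF; rewrite !ffunE => -[] Dt.
have /andP[l1 u1] := trunc_itv (h0 z i); have /andP[l2 u2] := trunc_itv (h0 z' i).
rewrite -Dt in l2 u2.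
have close s t : t < (Num.trunc (h z i)).+1%:R -> (Num.trunc (h z i))%:R <= s -> t - s < 1.
  move=> ut ls; rewrite ltrBlDl (lt_le_trans ut) // -addn1 natrD addrC [leRHS]addrC.
  by rewrite lerD2l.
rewrite real_ltr_norml ?rpredB ?ger0_real // ltrNl opprB.
by rewrite !close.
Qed.

(** A primitive element becomes integral after multiplication by the leading coefficient
    of its primitive minimal polynomial. *)
Lemma integral_generator (L : splittingFieldType rat)
    (iota : {rmorphism L -> algC}) (K : {subfield L}) :
  exists theta, [/\ theta \in K, iota theta \in Aint & <<1; theta>>%VS = K :> {vspace L}].
Proof.
have sepK : separable 1 K.
  by apply: separableSr (subvf K) _; have /and3P[] := galois1f L.
have DK := eq_adjoin_separable_generator sepK (sub1v K).
set s := separable_generator 1 K in DK.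
have sK : s \in K by rewrite separable_generator_mem.
set a := lead_coef (minZpoly (iota s)).
have a0 : a%:~R != 0 :> L.
  by rewrite -(fmorph_eq0 iota) rmorph_int intr_eq0 lead_coef_eq0 minZpoly_neq0.
exists (a%:~R * s); split; first by rewrite rpredM ?rpred_int.
  rewrite rmorphM rmorph_int /a -lead_coef_intr; apply: lead_root_Aint.
    by apply/polyOverP => i; rewrite coef_map Aint_int.
  by rewrite map_minZpoly rootZ ?root_minCpoly // intr_eq0 lead_coef_eq0 minZpoly_neq0.
rewrite DK; apply/eqP; rewrite eqEsubv; apply/andP; split; apply/FadjoinP; split.
- exact: sub1v.
- by rewrite rpredM ?rpred_int // memv_adjoin.
- exact: sub1v.
rewrite -[X in X \in _](mulKf a0 s).
by rewrite rpredM ?rpredV ?rpred_int // memv_adjoin.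
Qed.

Section Embeddings.

Variables (L : splittingFieldType rat) (iota : {rmorphism L -> algC}).
Variable K : {subfield L}.

Local Notation G := 'Gal({:L} / 1)%g.
Local Notation conjs := (conjs {:L}).

Variables (theta : L) (e : 'I_4 -> gal_of {:L}).

(** The four embeddings of K = Q(theta), as restrictions of automorphisms of L. *)
Definition embeddings :=
  [/\ <<1; theta>>%VS = K :> {vspace L}, iota theta \in Aint,
      forall i, e i \in G, injective (fun i => e i theta)
    & forall g, g \in G -> exists i, g theta = e i theta].

Hypothesis embP : embeddings.

Lemma theta_mem : theta \in K.
Proof. by have [<- _ _ _ _] := embP; rewrite memv_adjoin. Qed.

Lemma emb_gal i : e i \in G. Proof. by have [_ _ ->] := embP. Qed.

Lemma emb_eq g h x : g \in G -> h \in G -> g theta = h theta -> x \in K -> g x = h x.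
Proof.
have [DK _ _ _ _] := embP; move=> gG hG eq_gh.
have -> : (x \in K) = (x \in <<1; theta>>%VS) by rewrite DK.
case/Fadjoin_polyP => p p1 ->.
rewrite -!horner_map !(fixedPoly_gal (sub1v _) _ p1) //=.
by rewrite eq_gh.
Qed.

(** The permutation of the embeddings: g after e i restricts to e (gact g i) on K. The
    default value is never reached for g in the Galois group. *)
Definition gact (g : gal_of {:L}) (i : 'I_4) : 'I_4 :=
  odflt i [pick j | e j theta == g (e i theta)].

Lemma gact_emb g i x : g \in G -> x \in K -> g (e i x) = e (gact g i) x.
Proof.
move=> gG xK; rewrite -galM ?memvf //.
apply: emb_eq => //; first by rewrite groupM ?emb_gal.
  exact: emb_gal.
rewrite galM ?memvf // /gact; case: pickP => [j /eqP-> //|none].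
have [_ _ _ _ /(_ (e i * g)%g)[|j Dj]] := embP; first by rewrite groupM ?emb_gal.
by have := none j; rewrite -Dj galM ?memvf // eqxx.
Qed.

Lemma emb_inj i j : e i theta = e j theta -> i = j.
Proof. by have [_ _ _ + _] := embP; apply. Qed.

Lemma gact_inj g : g \in G -> injective (gact g).
Proof.
move=> gG i j eq_ij; apply: emb_inj; apply: (fmorph_inj g).
by rewrite /= !gact_emb ?theta_mem // eq_ij.
Qed.

Lemma gact_trans i j : exists2 g, g \in G & gact g i = j.
Proof.
exists ((e i)^-1 * e j)%g; first by rewrite groupM ?groupV ?emb_gal.
apply: emb_inj; rewrite -gact_emb ?theta_mem ?groupM ?groupV ?emb_gal //.
by rewrite -galM ?memvf // mulKVg.
Qed.

Lemma gactM g h i : g \in G -> h \in G -> gact (g * h)%g i = gact h (gact g i).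
Proof.
move=> gG hG; apply: emb_inj; rewrite -!gact_emb ?theta_mem ?groupM //.
by rewrite galM ?memvf.
Qed.

Lemma gact_id i : gact 1%g i = i.
Proof. by apply: emb_inj; rewrite -gact_emb ?theta_mem ?group1 // gal_id. Qed.

Lemma emb_id : exists i, {in K, forall x, e i x = x}.
Proof.
have [_ _ _ _ /(_ 1%g)[|i Di]] := embP; first exact: group1.
exists i => x xK; rewrite -[RHS](@gal_id _ _ {:L} x).
by apply: emb_eq => //; rewrite ?emb_gal ?group1.
Qed.

(** The stabiliser of i is the conjugate by e i of the group fixing K, so its fixed
    field is e i K. *)
Lemma emb_mem_gal i v : (forall g, g \in G -> gact g i = i -> g v = v) ->
  (e i)^-1%g v \in K.
Proof.
move=> fv; have galK : galois K {:L} by apply: galoisS (galois1f L); rewrite sub1v subvf.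
have /galois_fixedField <- := galK.
apply/fixedFieldP => [|h hH]; first exact: memvf.
have hG : h \in G by apply: (fintype.subsetP (galS _ (sub1v K))).
have cG : ((e i)^-1 * h * e i)%g \in G by rewrite !groupM ?groupV ?emb_gal.
have ci : gact ((e i)^-1 * h * e i)%g i = i.
  apply: emb_inj; rewrite -gact_emb ?theta_mem //.
  rewrite -galM ?memvf // !mulgA mulgV mul1g galM ?memvf //.
  by rewrite (fixed_gal (subvf K) hH) ?theta_mem.
rewrite -galM ?memvf //.
have -> : ((e i)^-1 * h)%g = ((e i)^-1 * h * e i * (e i)^-1)%g by rewrite mulgK.
by rewrite galM ?memvf // (fv _ cG ci).
Qed.

Lemma emb_prod_fixed x g : x \in K -> g \in G -> g (\prod_i e i x) = \prod_i e i x.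
Proof.
move=> xK gG; rewrite rmorph_prod [RHS](reindex_inj (gact_inj gG)) /=.
by apply: eq_bigr => i _; rewrite gact_emb.
Qed.

Lemma emb_Aint i x : iota x \in Aint -> iota (e i x) \in Aint.
Proof.
move=> xA; apply: (conjs_Aint (galois1f L) (memvf x) xA).
by apply/conjsP; exists (e i); rewrite ?emb_gal.
Qed.

Lemma norm_int x : x \in K -> iota x \in Aint -> iota (\prod_i e i x) \is a Num.int.
Proof.
move=> xK xA; apply: (fixed_int (galois1f L)); rewrite ?memvf //.
  by rewrite rmorph_prod rpred_prod // => i _; rewrite emb_Aint.
by move=> g; apply: emb_prod_fixed.
Qed.

Lemma norm_ge1 x : x \in K -> iota x \in Aint -> x != 0 ->
  1 <= \prod_i `|iota (e i x)|.
Proof.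
move=> xK xA x0; rewrite -normr_prod -rmorph_prod norm_intr_ge1 ?norm_int //.
by rewrite fmorph_eq0 prodf_seq_neq0; apply/allP => i _; rewrite fmorph_eq0.
Qed.

(** Up to sign x divides its norm, the quotient being the product of the other
    conjugates, and the norm divides n!. *)
Lemma norm_div_Aint x n : x \in K -> iota x \in Aint -> x != 0 ->
  \prod_i `|iota (e i x)| <= n%:R -> iota (n`!%:R / x) \in Aint.
Proof.
move=> xK xA x0 le_n; have /intrP[c Dc] := norm_int xK xA.
have [i0 ei0] := emb_id.
have Dx : \prod_i e i x = x * \prod_(i | i != i0) e i x by rewrite (bigD1 i0) //= ei0.
have cn : (`|c| <= n)%N.
  move: le_n; rewrite -normr_prod -rmorph_prod Dc -intr_norm.
  by rewrite -[n%:R]/(n%:~R) ler_int -lez_nat abszE.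
have c_gt0 : (0 < `|c|)%N.
  rewrite absz_gt0 -(@intr_eq0 algC) -Dc fmorph_eq0 prodf_seq_neq0.
  by apply/allP => i _; rewrite fmorph_eq0.
have /dvdnP[q Dq] : (`|c| %| n`!)%N by rewrite dvdn_fact // c_gt0.
have -> : n`!%:R / x = q%:R * (sgz c)%:~R * \prod_(i | i != i0) e i x.
  rewrite Dq natrM -[`|c|%N%:R]/(`|c|%N%:~R) abszEsg rmorphM -!mulrA; congr (_ * _).
  rewrite /= -[c%:~R]/(c%:~R : L); congr (_ * _).
  have -> : c%:~R = \prod_i e i x by apply: (fmorph_inj iota); rewrite Dc rmorph_int.
  by rewrite Dx mulrC mulKf.
rewrite !rmorphM rmorph_nat rmorph_int rmorph_prod /= !rpredM ?rpred_nat ?rpred_int //.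
by rewrite rpred_prod // => i _; rewrite emb_Aint.
Qed.

End Embeddings.

Lemma ler_exprz (c : algC) (m n : int) : 1 <= c -> m <= n -> c ^ m <= c ^ n.
Proof.
move=> c1 le_mn; have c0 : 0 < c := lt_le_trans ltr01 c1.
rewrite -(subrK m n) [n - m + m]addrC -[n - m]gez0_abs ?subr_ge0 //.
by rewrite expfzDr ?gt_eqF // ler_peMr ?exprn_ege1 // ltW ?exprz_gt0.
Qed.

Lemma ltr_exprz (c : algC) (m n : int) : 1 < c -> m < n -> c ^ m < c ^ n.
Proof.
move=> c1 lt_mn; have c0 : 0 < c := lt_trans ltr01 c1.
have le1 : m + 1 <= n by rewrite lezD1.
apply: lt_le_trans (ler_exprz (ltW c1) le1).
by rewrite expfzDr ?gt_eqF // expr1z ltr_pMr // exprz_gt0.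
Qed.

Fact exponent_lower (m d w : int) : 1 <= d -> 1 + (d * (w - 1) + m * w) <= (m + d) * w.
Proof. by move=> d1; lia. Qed.

Fact exponent_upper (d w : int) : 1 <= d -> 1 + d * w <= d * (w + 1).
Proof. by move=> d1; lia. Qed.

Lemma exists_embeddings (L : splittingFieldType rat)
    (iota : {rmorphism L -> algC}) (K : {subfield L}) :
  \dim K = 4%N -> exists theta e, embeddings iota K theta e.
Proof.
move=> dimK; have [theta [thK thA DK]] := integral_generator iota K.
have sz4 : size (conjs {:L} theta) = 4%N.
  have /eqP := size_minPoly 1 theta.
  rewrite (minPoly_conjs (galois1f L)) ?memvf // size_prod_XsubC eqSS => /eqP ->.
  by rewrite -dimK -DK dim_Fadjoin dimv1 muln1.
have [|e eG De] := @fin_all_exists2 _ (fun=> gal_of {:L})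
    (fun i g => g \in 'Gal({:L} / 1)%g)
    (fun (i : 'I_4) g => nth 0 (conjs {:L} theta) i = g theta).
  by move=> i; apply/conjsP; rewrite mem_nth // sz4.
exists theta, e; split=> // [i j|g gG].
  rewrite -!De => /eqP; rewrite nth_uniq ?sz4 ?conjs_uniq //.
  by move/eqP/val_inj.
have gc : g theta \in conjs {:L} theta by apply/conjsP; exists g.
have lt4 : (index (g theta) (conjs {:L} theta) < 4)%N by rewrite -sz4 index_mem.
by exists (Ordinal lt4); rewrite -De /= nth_index.
Qed.

Section Units.

Variables (L : splittingFieldType rat) (iota : {rmorphism L -> algC}).
Variable K : {subfield L}.
Hypotheses (dimK : \dim K = 4%N) (realK : totally_real K).

Local Notation G := 'Gal({:L} / 1)%g.

Variables (theta : L) (e : 'I_4 -> gal_of {:L}).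
Hypothesis embP : embeddings iota K theta e.

Lemma emb_real g x : g \in G -> x \in K -> iota (g x) \is Num.real.
Proof.
by move=> gG xK; exact: (realK (iota \o g \o @vsval _ _ K) (Subvs xK)).
Qed.

(** Z[theta], whose elements are given by their coordinates on the powers of theta. *)
Definition lattice (z : 'I_4 -> int) : L := \sum_k (z k)%:~R * theta ^+ k.

Lemma lattice_mem z : lattice z \in K.
Proof.
have thK := theta_mem embP.
by apply: rpred_sum => k _; rewrite rpredM ?rpred_int ?rpredX.
Qed.

Lemma lattice_Aint z : iota (lattice z) \in Aint.
Proof.
have [_ thA _ _ _] := embP; rewrite rmorph_sum rpred_sum // => k _.
by rewrite rmorphM rmorph_int rmorphXn rpredM ?rpred_int ?rpredX.
Qed.

(** theta has degree four. *)
Lemma lattice_neq0 z k : z k != 0 -> lattice z != 0.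
Proof.
apply: contraNneq => z0; pose p := \poly_(j < 4) ((z (inord j))%:~R : L).
have p1 : p \is a polyOver 1%VS.
  by apply/polyOverP => j; rewrite coef_poly; case: ifP; rewrite ?rpred0 ?rpred_int.
have rp : root p theta.
  rewrite rootE horner_poly; apply/eqP; rewrite -[RHS]z0 /lattice.
  by apply: eq_bigr => j _; rewrite inord_val.
have p0 : p = 0.
  apply/eqP; apply: contraTT (minPoly_dvdp p1 rp) => nz; apply/negP => /(dvdp_leq nz).
  rewrite size_minPoly leqNgt; case/negP; rewrite ltnS.
  apply: leq_trans (size_poly _ _) _.
  have [DK _ _ _ _] := embP.
  by rewrite -[adjoin_degree _ _]muln1 -[X in (_ * X)%N](dimv1 L) -dim_Fadjoin DK dimK.
have := congr1 (fun q : {poly L} => q`_k) p0; rewrite coef_poly ltn_ord coef0 inord_val.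
by move/eqP; rewrite -(fmorph_eq0 iota) rmorph_int intr_eq0.
Qed.

Lemma lattice_emb z i :
  iota (e i (lattice z)) = \sum_(k < 4) iota (e i theta) ^+ k * (z k)%:~R.
Proof.
rewrite !rmorph_sum; apply: eq_bigr => k _.
by rewrite !rmorphM !rmorph_int !rmorphXn mulrC.
Qed.

Lemma latticeB z z' : lattice z - lattice z' = lattice (fun k => z k - z' k).
Proof. by rewrite -sumrB; apply: eq_bigr => k _; rewrite rmorphB mulrBl. Qed.

Lemma lattice_dvd q z : (forall k, (q %| z k)%Z) ->
  exists y, lattice z = q%:~R * lattice y.
Proof.
move=> dv; exists (fun k => (z k %/ q)%Z); rewrite mulr_sumr; apply: eq_bigr => k _.
by rewrite -{1}(divzK (dv k)) rmorphM mulrA [_ * q%:~R]mulrC.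
Qed.

(** The i-th conjugate of the lattice point has size about C^(m (W - a i)), with an
    error independent of m; so the norm stays bounded. *)
Definition balanced (D : nat) (a : 'I_4 -> nat) (W m : nat) (z : 'I_4 -> int) :=
  let C : algC := (D ^ 4)%:R in
  let y i := `|iota (e i (lattice z))| in
  [/\ lattice z != 0,
      forall i, y i * C ^+ (m * a i) <= D%:R * C ^+ (m * W),
      forall i, C ^+ (m * W) <= D%:R ^+ 3 * (y i * C ^+ (m * a i))
    & \prod_i y i <= C].

Lemma balanced_exists : exists2 D : nat, (1 < D)%N & forall (a : 'I_4 -> nat) (W : nat),
  (\sum_i a i)%N = (4 * W)%N -> forall m, exists z, balanced D a W m z.
Proof.
have [|i k|D D1 small] := @small_linear_forms 4 (fun i (k : 'I_4) => iota (e i theta) ^+ k).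
- by [].
- by rewrite rpredX // emb_real ?(emb_gal embP) // (theta_mem embP).
exists D => // a W sumW; rewrite /balanced.
set C := (D ^ 4)%N.
have C_gt0 : (0 < C)%N by rewrite expn_gt0 ltnW.
have Cn0 n : 0 < C%:R ^+ n :> algC by rewrite exprn_gt0 // ltr0n.
move=> m; have [|i||z [k zk] bound] := small (C ^ (m * W))%N (fun i => C ^ (m * a i))%N.
- by rewrite expn_gt0 C_gt0.
- by rewrite expn_gt0 C_gt0.
- rewrite -expn_sum -big_distrr /= sumW mulnCA mulnC expnM ltn_exp2r //.
have x0 : lattice z != 0 by exact: lattice_neq0 zk.
exists z; set x := lattice z in x0 *.
have up i : `|iota (e i x)| * C%:R ^+ (m * a i) <= D%:R * C%:R ^+ (m * W).
  by rewrite lattice_emb -!natrX.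
have n1 := norm_ge1 embP (lattice_mem z) (lattice_Aint z) x0.
have prodC : \prod_(i < 4) C%:R ^+ (m * a i) = (C%:R ^+ (m * W)) ^+ 4 :> algC.
  by rewrite prodrXr -big_distrr /= sumW -exprM mulnCA mulnC.
have lep (P : pred 'I_4) : \prod_(j | P j) (`|iota (e j x)| * C%:R ^+ (m * a j))
    <= \prod_(j | P j) (D%:R * C%:R ^+ (m * W)).
  by apply: ler_prod => j _; rewrite up mulr_ge0 // ltW.
split=> // [i|].
  rewrite -(ler_pM2r (exprn_gt0 3 (Cn0 (m * W)%N))) -exprS.
  rewrite -prodC (le_trans (ler_peMl _ n1)) ?prodr_ge0 // => [j _|]; first exact: ltW.
  rewrite -big_split /= (bigD1 i) //= [leRHS]mulrAC [leRHS]mulrC ler_wpM2l //.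
    by rewrite mulr_ge0 // ltW.
  rewrite -exprMn.
  by rewrite (le_trans (lep _)) // prodr_const cardC1 card_ord.
have P0 : 0 < \prod_(i < 4) C%:R ^+ (m * a i) :> algC by apply: prodr_gt0.
rewrite -(ler_pM2r P0) -big_split /=.
by rewrite (le_trans (lep xpredT)) // prodr_const card_ord exprMn prodC natrX.
Qed.

(** The ratio of two balanced lattice points congruent modulo (D^4)! is a unit:
    either point divides (D^4)! because its norm is an integer at most D^4. *)
Lemma exists_unit (w : 'I_4 -> int) : \sum_i w i = 0 -> exists u v t,
  [/\ u \in K, v \in K, iota u \in Aint & iota v \in Aint]
  /\ [/\ u * v = 1, 1 < t &
         forall i, t ^ (w i - 1) <= `|iota (e i u)| <= t ^ (w i + 1)].
Proof.
move=> sum_w; have [D D1 bal] := balanced_exists.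
pose W := (\sum_i `|w i|)%N; pose a i := absz (W%:Z - w i).
have aE i : (a i)%:Z = W%:Z - w i.
  rewrite /a gez0_abs // subr_ge0 (le_trans (lez_abs _)) // lez_nat.
  by rewrite /W (bigD1 i) //= leq_addr.
have sum_a : (\sum_i a i)%N = (4 * W)%N.
  apply/eqP; rewrite -eqz_nat -natz natr_sum (eq_bigr (fun i => W%:Z - w i)).
    by rewrite sumrB sum_w subr0 sumr_const card_ord PoszM -mulr_natl natz.
  by move=> i _; rewrite -aE natz.
have [z zP] := choice (bal a W sum_a).
set C := (D ^ 4)%N; pose Q := C`!.
have Q_gt0 : (0 < Q)%N by rewrite fact_gt0.
have lt_mod m k : (`|(z m k %% Q)%Z| < Q)%N.
  by rewrite -ltz_nat gez0_abs ?modz_ge0 ?ltz_pmod ?eqz_nat -?lt0n.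
pose r (m : 'I_(Q ^ 4).+1) : {ffun 'I_4 -> 'I_Q} := [ffun k => Ordinal (lt_mod m k)].
have [m [m' [lt_mm' congr_mm']]] : exists m m' : nat, (m < m')%N /\
    forall k, (z m k %% Q)%Z = (z m' k %% Q)%Z.
  have /injectivePn[m [m' nmm' rr]] : ~~ injectiveb r.
    apply/negP=> /injectiveP /leq_card; apply/negP; rewrite -ltnNge.
    by rewrite card_ffun !card_ord.
  have eq_mod k : (z m k %% Q)%Z = (z m' k %% Q)%Z.
    have /ffunP/(_ k) := rr; rewrite !ffunE => -[] /(congr1 Posz).
    by rewrite !gez0_abs // modz_ge0 // eqz_nat -lt0n.
  case: (ltngtP m m') => [lt|lt|eq].
  - by exists m, m'.
  - by exists m', m; split=> // k; rewrite eq_mod.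
  - by case/eqP: nmm'; apply: val_inj.
pose x := lattice (z m); pose x' := lattice (z m').
have [x0 upx lowx normx] := zP m; have [x'0 upx' lowx' normx'] := zP m'.
rewrite -/x -/x' in x0 upx lowx normx x'0 upx' lowx' normx'.
have [y Dy] : exists y, x' - x = Q%:~R * lattice y.
  rewrite /x /x' latticeB; apply: lattice_dvd => k.
  by rewrite -eqz_mod_dvd congr_mm'.
have xK : x \in K by exact: lattice_mem.
have x'K : x' \in K by exact: lattice_mem.
have QxA := norm_div_Aint embP xK (lattice_Aint _) x0 normx.
have Qx'A := norm_div_Aint embP x'K (lattice_Aint _) x'0 normx'.
have C1 : 1 < C%:R :> algC by rewrite ltr1n (@ltn_exp2r 1 D 4).
have C0 : 0 < C%:R :> algC := lt_trans ltr01 C1.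
pose d := (m' - m)%N.
have d_gt0 : (0 < d)%N by rewrite subn_gt0.
exists (x' / x), (x / x'), (C%:R ^+ d); split; split.
- by rewrite rpred_div.
- by rewrite rpred_div.
- have -> : x' / x = 1 + Q%:R / x * lattice y.
    by rewrite mulrAC -[Q%:R]/(Q%:~R) -Dy mulrBl divff // addrC subrK.
  by rewrite rmorphD rmorph1 rmorphM rpredD ?rpred1 // rpredM // lattice_Aint.
- have -> : x / x' = 1 - Q%:R / x' * lattice y.
    by rewrite mulrAC -[Q%:R]/(Q%:~R) -Dy mulrBl divff // opprB addrC subrK.
  by rewrite rmorphB rmorph1 rmorphM rpredB ?rpred1 // rpredM // lattice_Aint.
- by rewrite mulrA divfK // divff.
- by rewrite exprn_egt1 -?lt0n.
move=> i; set X := `|iota (e i x)| in upx lowx *.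
have X0 : 0 < `|iota (e i x)| by rewrite normr_gt0 !fmorph_eq0.
have X'0 : 0 < `|iota (e i x')| by rewrite normr_gt0 !fmorph_eq0.
rewrite fmorph_div fmorph_div normf_div.
have expC n : C%:R ^+ (n * W) = C%:R ^ (n%:Z * w i) * C%:R ^+ (n * a i) :> algC.
  rewrite !exprnP -expfzDr ?gt_eqF //; congr (_ ^ _).
  by rewrite !PoszM aE mulrBr addrC subrK.
have Cn0 n : 0 < C%:R ^+ n :> algC by rewrite exprn_gt0.
have up n (s : algC) : s * C%:R ^+ (n * a i) <= D%:R * C%:R ^+ (n * W) ->
    s <= D%:R * C%:R ^ (n%:Z * w i).
  by rewrite expC mulrA ler_pM2r.
have low n (s : algC) : C%:R ^+ (n * W) <= D%:R ^+ 3 * (s * C%:R ^+ (n * a i)) ->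
    C%:R ^ (n%:Z * w i) <= D%:R ^+ 3 * s.
  by rewrite expC mulrA ler_pM2r.
have {}upx := up _ _ (upx i); have {}upx' := up _ _ (upx' i).
have {}lowx := low _ _ (lowx i); have {}lowx' := low _ _ (lowx' i).
have DC : D%:R * D%:R ^+ 3 = C%:R :> algC by rewrite -exprS natrX.
have expd (k : int) : (C%:R ^+ d) ^ k = C%:R ^ (d%:Z * k) :> algC.
  by rewrite exprnP exprz_exp.
have Dd : m'%:Z = m%:Z + d%:Z by rewrite -PoszD subnKC // ltnW.
have CZ k : 0 < C%:R ^ k :> algC by rewrite exprz_gt0.
have D0 : 0 < D%:R :> algC by rewrite ltr0n ltnW.
have powD (p q : int) : C%:R ^ (p + q) = C%:R ^ p * C%:R ^ q :> algC.
  by rewrite expfzDr ?gt_eqF.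
apply/andP; split.
  rewrite ler_pdivlMr // expd -(ler_pM2l C0).
  apply: le_trans (_ : D%:R * C%:R ^ (m'%:Z * w i) <= _); last first.
    by rewrite -{2}DC -mulrA ler_pM2l.
  apply: le_trans (_ : C%:R * (C%:R ^ (d%:Z * (w i - 1)) * (D%:R * C%:R ^ (m%:Z * w i))) <= _).
    by rewrite !ler_pM2l.
  rewrite [X in _ * X <= _]mulrCA [leLHS]mulrCA ler_pM2l // -{1}[C%:R]expr1z -!powD.
  by apply: ler_exprz (ltW C1) _; rewrite Dd; apply: exponent_lower.
rewrite ler_pdivrMr // expd; apply: le_trans upx' _.
apply: le_trans (_ : D%:R * (C%:R ^ (d%:Z * w i) * (D%:R ^+ 3 * X)) <= _).
  by rewrite ler_pM2l // Dd mulrDl addrC powD ler_pM2l.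
rewrite [X in _ * X <= _]mulrA [leLHS]mulrA ler_pM2r // mulrCA DC.
rewrite [leLHS]mulrC -{1}[C%:R]expr1z -powD.
by apply: ler_exprz (ltW C1) _; apply: exponent_upper.
Qed.

End Units.

(** * The Galois action on pairs of embeddings *)

Section Pairs.

Variables (L : splittingFieldType rat) (iota : {rmorphism L -> algC}).
Variable K : {subfield L}.
Hypothesis dimK : \dim K = 4%N.

Local Notation G := 'Gal({:L} / 1)%g.

Variables (theta : L) (e : 'I_4 -> gal_of {:L}).
Hypothesis embP : embeddings iota K theta e.

Local Notation gact := (gact theta e).

(** A permutation preserving the three splittings of four points into two pairs lies in
    the Klein four-group: it is an involution, and it is the identity if it has a
    fixed point. Hence the group fixing K fixes every conjugate of K, so K is normal, and
    its Galois group has exponent two. *)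
Lemma unsplit_biquadratic :
  (forall g, g \in G -> forall i j, i != j ->
     (gact g i \in [:: i; j]) = (gact g j \in [:: i; j])) ->
  biquadratic K.
Proof.
move=> uns.
have gI g : g \in G -> injective (gact g) by move=> gG; exact: (gact_inj embP gG).
have fix_id g i j : g \in G -> gact g i = i -> gact g j = j.
  move=> gG gi; have [->//|ne] := eqVneq j i.
  have := uns g gG i j; rewrite eq_sym ne gi !inE eqxx => /(_ isT)/esym/orP[] /eqP // gj.
  by case/eqP: ne; apply: (gI g gG); rewrite gi gj.
have invol g i : g \in G -> gact g (gact g i) = i.
  move=> gG; have [gi|ne] := eqVneq (gact g i) i; first by rewrite !gi.
  have := uns g gG i (gact g i); rewrite eq_sym ne !inE eqxx orbT.
  by move/(_ isT)/esym/orP => [] /eqP // /(gI g gG) gi; case/eqP: ne.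
have [i0 ei0] := emb_id embP.
have embK i x : x \in K -> e i x \in K.
  move=> xK; have galK : galois K {:L} by apply: galoisS (galois1f L); rewrite sub1v subvf.
  have /galois_fixedField <- := galK.
  apply/fixedFieldP => [|h hH]; first exact: memvf.
  have hG : h \in G by apply: (fintype.subsetP (galS _ (sub1v K))).
  rewrite (gact_emb embP) // (fix_id h i0) //.
  apply: (emb_inj embP); rewrite -(gact_emb embP) ?(theta_mem embP) //.
  rewrite ei0 ?(theta_mem embP) //.
  by rewrite (fixed_gal (subvf K) hH) // (theta_mem embP).
have galE x g : g \in G -> x \in K -> g x = e (gact g i0) x.
  by move=> gG xK; rewrite -(gact_emb embP) // ei0.
have galK : galois 1 K.
  have /and3P[_ sepL _] := galois1f L.
  rewrite /galois sub1v (separableSr (subvf K) sepL) /=; apply/normalFieldP => a aK.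
  exists (conjs {:L} a); last by rewrite (minPoly_conjs (galois1f L)) ?memvf.
  by apply/allP => _ /conjsP[g gG ->] /=; rewrite galE // embK.
have exK g : g \in 'Gal(K / 1)%g -> (g ^+ 2 = 1)%g.
  rewrite gal_kHom ?sub1v // => homg.
  have s1KL : (1 <= K <= {:L})%VS by rewrite sub1v subvf.
  have [h hG Dg] := kHom_to_gal s1KL (normalFieldf 1) homg.
  apply/eqP/gal_eqP => x xK; rewrite expg2 galM // gal_id Dg ?memv_gal // Dg //.
  by rewrite [h x]galE // (gact_emb embP) // invol // ei0.
split=> //; have [ab c4] := klein_abelem.
rewrite isog_sym (isog_abelem_card _ ab) c4 -(galois_dim galK) dimv1 divn1 dimK eqxx andbT.
apply/abelemP => //; split=> //; apply/centsP => g gG h hG.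
have inv x : x \in 'Gal(K / 1)%g -> (x^-1)%g = x.
  by move=> xG; apply/eqP; rewrite eq_invg_mul -expg2 exK.
by rewrite /commute -[LHS]inv ?groupM // invMg !inv.
Qed.

(** The orbit of the pair {a, b}, as a graph on the embeddings. *)
Definition edge (a b x y : 'I_4) : bool :=
  [exists g in G, (gact g a == x) && (gact g b == y)
               || (gact g a == y) && (gact g b == x)].

Lemma edgeP a b x y : reflect (exists2 g, g \in G &
    (gact g a = x /\ gact g b = y) \/ (gact g a = y /\ gact g b = x)) (edge a b x y).
Proof.
apply: (iffP exists_inP) => -[g gG].
  by case/orP => /andP[/eqP ga /eqP gb]; exists g => //; [left | right].
by case=> -[ga gb]; exists g => //; rewrite ga gb !eqxx ?orbT.
Qed.

Lemma edge_refl a b : edge a b a b.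
Proof. by apply/edgeP; exists 1%g; rewrite ?group1 // !(gact_id embP); left. Qed.

Lemma edge_sym a b x y : edge a b x y = edge a b y x.
Proof.
apply/edgeP/edgeP => -[g gG [[]|[]] ga gb]; exists g => //;
  by [right | left | right | left].
Qed.

Lemma edge_act a b x y g : g \in G -> edge a b (gact g x) (gact g y) = edge a b x y.
Proof.
move=> gG; have gI := gact_inj embP gG; apply/edgeP/edgeP => -[h hG hab].
  exists (h * g^-1)%g; first by rewrite groupM ?groupV.
  have act i z : gact h i = gact g z -> gact (h * g^-1)%g i = z.
    move=> hi; apply: gI; rewrite -(gactM embP) ?groupM ?groupV //.
    by rewrite mulgKV.
  by case: hab => -[/act -> /act ->]; [left | right].
exists (h * g)%g; first by rewrite groupM.
by rewrite !(gactM embP) //; case: hab => -[-> ->]; [left | right].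
Qed.

Lemma edge_irrefl a b x : a != b -> edge a b x x = false.
Proof.
move=> ne; apply/edgeP => -[g gG [[]|[]] <- /(gact_inj embP gG) ab];
  by rewrite ab eqxx in ne.
Qed.

(** The group acts transitively on the vertices and preserves the edges. *)
Lemma edge_regular a b x y :
  (\sum_z edge a b x z = \sum_z edge a b y z)%N.
Proof.
have [g gG <-] := gact_trans embP x y.
rewrite [RHS](reindex_inj (gact_inj embP gG)) /=.
by apply: eq_bigr => z _; rewrite edge_act.
Qed.

Lemma edge_base a b c d x y : edge a b c d -> edge c d x y = edge a b x y.
Proof.
case/edgeP => g gG gab; apply/edgeP/edgeP => -[h hG hcd].
  exists (g * h)%g; rewrite ?groupM // !(gactM embP) //.
  by case: gab hcd => -[-> ->] [] []; [left|right|right|left].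
exists (g^-1 * h)%g; rewrite ?groupM ?groupV //.
have act i z : gact g i = z -> gact (g^-1 * h)%g z = gact h i.
  by move=> <-; rewrite -(gactM embP) ?groupM ?groupV // mulKVg.
by case: gab => -[/act -> /act ->]; case: hcd => -[-> ->]; [left|right|right|left].
Qed.

End Pairs.

Lemma ord4_perm (a b c d : 'I_4) :
  uniq [:: a; b; c; d] -> perm_eq (index_enum 'I_4) [:: a; b; c; d].
Proof.
move=> us; rewrite /index_enum -enumT; apply: uniq_perm; rewrite ?enum_uniq // => w.
rewrite mem_enum; have /subset_cardP sub : #|[:: a; b; c; d]| = #|'I_4|.
  by rewrite (card_uniqP us) card_ord.
by rewrite (sub _) //; apply/fintype.subsetP.
Qed.

(** The common degree is two or three. If it is two, the vertex that is not adjacent to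
    x is joined to the two neighbours of x, and the graph is a 4-cycle. *)
Lemma regular_graph4 (E : rel 'I_4) :
  symmetric E -> irreflexive E ->
  (forall x y, \sum_z E x z = \sum_z E y z)%N ->
  (exists x y z, [/\ y != z, E x y & E x z]) ->
  exists i0 i1 i2 i3, [/\ uniq [:: i0; i1; i2; i3], E i0 i1 &
    (forall x y, x != y -> E x y) \/
    [/\ E i0 i1, E i1 i2, E i2 i3, E i3 i0 & ~~ E i0 i2 /\ ~~ E i1 i3]].
Proof.
move=> symE irrE regE [x [y [z [nyz xy xz]]]].
have nxy : x != y by apply: contraTneq xy => ->; rewrite irrE.
have nxz : x != z by apply: contraTneq xz => ->; rewrite irrE.
have [t ut] : exists t, uniq [:: x; y; t; z].
  have : (0 < #|[predC [:: x; y; z]]|)%N.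
    rewrite -(leq_add2l #|[:: x; y; z]|) cardC card_ord.
    by rewrite addn1 ltnS card_size.
  case/card_gt0P => t; rewrite !inE !negb_or => /and3P[tx ty tz]; exists t.
  by rewrite /= !inE !negb_or nxy nxz nyz tz eq_sym tx eq_sym ty.
have allE (w : 'I_4) : w \in [:: x; y; t; z].
  by rewrite -(perm_mem (ord4_perm ut)) mem_index_enum.
have sumE (F : 'I_4 -> nat) : (\sum_w F w = F x + F y + F t + F z)%N.
  by rewrite (perm_big _ (ord4_perm ut)) /= !big_cons big_nil !addnA addn0.
have := regE x y; have := regE x t; have := regE x z; rewrite !sumE !irrE.
rewrite ![E y x]symE ![E t x]symE ![E z x]symE ![E t y]symE ![E z y]symE ![E z t]symE.
rewrite xy xz /= => r1 r2 r3.
exists x, y, t, z; split=> //.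
have [xt|xt] := boolP (E x t).
  left=> a b; rewrite xt in r1 r2 r3.
  have [yt yz tz] : [/\ E y t, E y z & E t z].
    by move: r1 r2 r3; case: (E y t); case: (E y z); case: (E t z).
  have := allE a; have := allE b; rewrite !inE.
  by do 2!case/or4P => /eqP->; rewrite ?eqxx // => _; rewrite // symE.
right; rewrite (negbTE xt) in r1 r2 r3.
by move: r1 r2 r3; rewrite [E z x]symE; case: (E y t); case: (E y z); case: (E t z).
Qed.

(** * Wandering units *)

Lemma uniq_map_inj (T1 T2 : eqType) (f : T1 -> T2) (s : seq T1) :
  uniq (map f s) -> {in s &, injective f}.
Proof.
elim: s => // a s IHs /= /andP[fa us] x y; rewrite !inE.
case/predU1P => [->|xs] /predU1P[->|ys] // eq_f.
- by rewrite eq_f map_f in fa.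
- by rewrite -eq_f map_f in fa.
- exact: IHs.
Qed.

Lemma max1_gt (a : algC) : 1 < a -> Num.max 1 a = a.
Proof. by move=> a1; rewrite /Order.max a1. Qed.

Lemma max1_lt (a : algC) : a < 1 -> Num.max 1 a = 1.
Proof. by move=> a1; rewrite /Order.max (lt_gtF a1). Qed.

Section Powers.

Variables (L : splittingFieldType rat) (iota : {rmorphism L -> algC}).

Local Notation conjs := (conjs {:L}).

(** The condition on the conjugates of x under which the Mahler measure commutes with
    powers of x. *)
Definition distinct_abs (x : L) := uniq [seq `|iota y| | y <- conjs x].

Lemma mahler_Aint_prod x (s : seq L) : iota x \in Aint -> perm_eq (conjs x) s ->
  mahler (iota x) = \prod_(y <- s) Num.max 1 `|iota y|.
Proof.
move=> xA xs; rewrite (mahler_conjs iota (galois1f L)) ?memvf // lead_minZpoly_Aint //.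
by rewrite mul1r (perm_big _ xs).
Qed.

(** Distinct absolute values of the conjugates of x keep the degree of x^k equal to
    that of x. *)
Lemma mahler_pow x k : (0 < k)%N -> iota x \in Aint -> distinct_abs x ->
  mahler (iota (x ^+ k)) = mahler (iota x) ^+ k.
Proof.
move=> k0 xA sx.
have xk : perm_eq (conjs (x ^+ k)) [seq y ^+ k | y <- conjs x].
  apply: (@conjs_map _ _ (fun y => y ^+ k)) => [g _|y z yx zx yz]; first by rewrite rmorphXn.
  apply: (uniq_map_inj sx) => //.
  by apply: (pexpIrn k0); rewrite ?nnegrE // -!normrX -!rmorphXn yz.
rewrite (mahler_Aint_prod _ xk) ?rmorphXn ?rpredX //.
rewrite (mahler_Aint_prod xA (perm_refl _)) big_map -prodrXl; apply: eq_bigr => y _.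
rewrite rmorphXn normrX; have [y1|y1|y1] := real_ltgtP (@real1 algC) (normr_real (iota y)).
- by rewrite !max1_gt // exprn_egt1 // -lt0n.
- by rewrite !max1_lt ?expr1n // exprn_ilt1 // -lt0n.
- by rewrite -y1 !expr1n maxxx.
Qed.

End Powers.

(** The iterate of order 2n + 1 is b^(2^n). *)
Lemma wandering_growth (z a b : algC) : 1 < b -> mahler z = b ->
  (forall k, (0 < k)%N -> mahler (b ^+ k) = a ^+ (2 * k)) ->
  (forall k, (0 < k)%N -> mahler (a ^+ k) = b ^+ k) -> wandering z.
Proof.
move=> b1 zb ba ab.
have orb n : iter (2 * n).+1 mahler z = b ^+ (2 ^ n).
  elim: n => [|n IHn]; first by rewrite muln0 expr1 /= zb.
  by rewrite mulnS add2n 2!iterS IHn ba ?expn_gt0 // -expnS ab ?expn_gt0.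
move/finite_seqP => [s Ds].
pose f n := b ^+ (2 ^ n).
have uf : uniq [seq f n | n <- iota 0 (size s).+1].
  rewrite map_inj_uniq ?iota_uniq // => m n.
  by move/(ieexprIn (lt_trans ltr01 b1) (negbT (gt_eqF b1))); exact: expnI.
have /(uniq_leq_size uf) : {subset [seq f n | n <- iota 0 (size s).+1] <= s}.
  move=> _ /mapP[n _ ->]; have : mahler_orbit z (f n) by exists (2 * n).+1.
  by rewrite Ds.
by rewrite size_map size_iota ltnn.
Qed.

Section WanderingUnit.

Variables (L : splittingFieldType rat) (iota : {rmorphism L -> algC}).

Local Notation conjs := (conjs {:L}).
Local Notation distinct_abs := (distinct_abs iota).

(** Up to sign, M sends y to z and z to y^2, and both steps commute with powers. *)
Lemma wandering_pair x y z :
  y \in conjs x -> iota x \in Aint -> iota y \is Num.real ->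
  iota z \in Aint -> iota z \is Num.real -> distinct_abs y -> distinct_abs z ->
  mahler (iota y) = `|iota z| -> mahler (iota z) = `|iota y| ^+ 2 ->
  1 < `|iota z| -> wandering (iota x).
Proof.
move=> yx xA yR zA zR sy sz yz zy z1; have galL := galois1f L.
have yA : iota y \in Aint := conjs_Aint galL (memvf x) xA yx.
have norm_pow t k : (0 < k)%N -> iota t \in Aint -> iota t \is Num.real -> distinct_abs t ->
    mahler (`|iota t| ^+ k) = mahler (iota t) ^+ k.
  move=> k0 tA tR st; rewrite -mahler_pow // -normrX -rmorphXn.
  by rewrite (mahler_norm galL) ?memvf // rmorphXn ?rpredX.
apply: (@wandering_growth _ `|iota y| `|iota z|) => // [|k k0|k k0].
- by rewrite -yz (mahler_conj galL (memvf x) xA yx).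
- by rewrite norm_pow // zy -exprM.
- by rewrite norm_pow // yz.
Qed.

(** Size bookkeeping: the logarithm of |x| in base t lies within r of p. *)
Definition near (t : algC) (x : L) (p r : int) :=
  (t ^ (p - r) <= `|iota x| <= t ^ (p + r)).

Section Near.

Variable t : algC.
Hypothesis t1 : 1 < t.

Let t0 : t != 0. Proof. by rewrite gt_eqF // (lt_trans ltr01 t1). Qed.

Lemma near_mul x y p q r s : near t x p r -> near t y q s ->
  near t (x * y) (p + q) (r + s).
Proof.
move=> /andP[x1 x2] /andP[y1 y2]; have tpos n : 0 <= t ^ n.
  by rewrite exprz_ge0 // ltW // (lt_trans ltr01 t1).
have Dl : p + q - (r + s) = (p - r) + (q - s) by lia.
have Du : p + q + (r + s) = (p + r) + (q + s) by lia.
rewrite /near rmorphM normrM Dl Du (expfzDr (p - r)) // (expfzDr (p + r)) //.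
by rewrite !ler_pM.
Qed.

Lemma near_inv x p r : x != 0 -> near t x p r -> near t x^-1 (- p) r.
Proof.
move=> x0 /andP[x1 x2]; have tpos n : 0 < t ^ n.
  by rewrite exprz_gt0 // (lt_trans ltr01 t1).
have X0 : 0 < `|iota x| by rewrite normr_gt0 fmorph_eq0.
have Dl : - p - r = - (p + r) by lia.
have Du : - p + r = - (p - r) by lia.
rewrite /near fmorphV normfV Dl Du -!invr_expz.
by rewrite !lef_pV2 ?posrE // x1 x2.
Qed.

Lemma near_lt x y p q r s : near t x p r -> near t y q s -> p + r < q - s ->
  `|iota x| < `|iota y|.
Proof.
move=> /andP[_ x2] /andP[y1 _] pq.
exact: le_lt_trans x2 (lt_le_trans (ltr_exprz t1 pq) y1).
Qed.

Lemma near_gt1 x p r : near t x p r -> 0 < p - r -> 1 < `|iota x|.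
Proof.
by move=> /andP[x1 _] pr; apply: lt_le_trans x1; rewrite -(expr0z t) ltr_exprz.
Qed.

Lemma near_lt1 x p r : near t x p r -> p + r < 0 -> `|iota x| < 1.
Proof.
by move=> /andP[_ x2] pr; apply: le_lt_trans x2 _; rewrite -(expr0z t) ltr_exprz.
Qed.

End Near.

(** Listing the conjugates by decreasing absolute value shows at once that the list has no
    repetition and that the absolute values are distinct. *)
Lemma sorted_conjs x (s : seq L) :
  (forall y, y \in conjs x <-> y \in s) ->
  sorted (fun a b => `|iota b| < `|iota a|) s -> perm_eq (conjs x) s /\ distinct_abs x.
Proof.
move=> xs ss; have us : uniq [seq `|iota y| | y <- s].
  apply: (@sorted_uniq _ (fun a b : algC => b < a)) => [a b c ba ac|a|].
  - exact: lt_trans ac ba.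
  - exact: ltxx.
  - by rewrite sorted_map.
have p_s : perm_eq (conjs x) s.
  apply: uniq_perm; rewrite ?conjs_uniq ?(map_uniq us) // => y.
  by apply/idP/idP => /xs.
by split; rewrite // /distinct_abs (perm_uniq (perm_map _ p_s)).
Qed.

End WanderingUnit.

Section NonBiquadratic.

Variables (L : splittingFieldType rat) (iota : {rmorphism L -> algC}).
Variable K : {subfield L}.
Hypotheses (dimK : \dim K = 4%N) (realK : totally_real K).

Local Notation G := 'Gal({:L} / 1)%g.
Local Notation conjs := (conjs {:L}).
Local Notation distinct_abs := (distinct_abs iota).

Variables (theta : L) (e : 'I_4 -> gal_of {:L}).
Hypothesis embP : embeddings iota K theta e.

Local Notation gact := (gact theta e).
Local Notation edge := (edge theta e).

Section Equivariant.

(** A family indexed by the embeddings and permuted like them: its members are the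
    conjugates of one element of K. *)
Variable v : 'I_4 -> L.
Hypothesis v_act : forall g, g \in G -> forall i, g (v i) = v (gact g i).
Hypothesis v_real : forall i, iota (v i) \is Num.real.
Hypothesis v_Aint : forall i, iota (v i) \in Aint.

(** The element x of K is v i transported back by the embedding e i. *)
Lemma wandering_unit_of i j : v i != 0 -> iota (v i)^-1 \in Aint ->
  distinct_abs (v i) -> distinct_abs (v i * v j) ->
  mahler (iota (v i)) = `|iota (v i * v j)| ->
  mahler (iota (v i * v j)) = `|iota (v i)| ^+ 2 ->
  1 < `|iota (v i * v j)| ->
  exists x, algebraic_unit iota K x /\ wandering (iota x).
Proof.
move=> vi0 viA si sij mi mij gt1; pose x := ((e i)^-1)%g (v i).
have xK : x \in K by apply: (emb_mem_gal embP) => g gG gi; rewrite v_act // gi.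
have VG : (e i)^-1%g \in G by rewrite groupV (emb_gal embP).
have conj_A (y : L) : iota y \in Aint -> iota (((e i)^-1)%g y) \in Aint.
  move=> yA; apply: (conjs_Aint (galois1f L) (memvf y) yA).
  by apply/conjsP; exists ((e i)^-1)%g.
have xA : iota x \in Aint by apply: conj_A.
exists x; split.
  split=> //; exists x^-1; split; first by rewrite rpredV.
    by rewrite /x -fmorphV conj_A.
  by rewrite divff // /x fmorph_eq0.
apply: (@wandering_pair _ iota x (v i) (v i * v j)) => //.
- apply/conjsP; exists (e i); first exact: (emb_gal embP).
  by rewrite /x -galM ?memvf // mulVg gal_id.
- by rewrite rmorphM rpredM.
- by rewrite rmorphM rpredM.
Qed.

Lemma conjs_vertex i s : (forall k, k \in s) ->
  forall y, y \in conjs (v i) <-> y \in [seq v k | k <- s].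
Proof.
move=> sT y; split=> [/conjsP[g gG ->]|/mapP[k _ ->]].
  by rewrite v_act // map_f.
have [g gG <-] := gact_trans embP i k.
by apply/conjsP; exists g; rewrite ?v_act.
Qed.

Lemma conjs_pair i j y : y \in conjs (v i * v j) <->
  exists a b, edge i j a b /\ y = v a * v b.
Proof.
split=> [/conjsP[g gG ->]|[a [b [/edgeP[g gG gij] ->]]]].
  exists (gact g i), (gact g j); split; last by rewrite rmorphM /= !v_act.
  by apply/edgeP; exists g => //; left.
apply/conjsP; exists g => //; rewrite rmorphM /= !v_act //.
by case: gij => -[-> ->] //; rewrite mulrC.
Qed.

End Equivariant.

Lemma emb_act u : u \in K -> forall g, g \in G -> forall i, g (e i u) = e (gact g i) u.
Proof. by move=> uK g gG i; rewrite (gact_emb embP). Qed.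

Lemma norm_unit u u' : u \in K -> u' \in K -> iota u \in Aint -> iota u' \in Aint ->
  u * u' = 1 -> \prod_i `|iota (e i u)| = 1.
Proof.
move=> uK u'K uA u'A uu'.
have u0 : u != 0 by apply: contra_eq_neq uu' => ->; rewrite mul0r eq_sym oner_neq0.
have u'0 : u' != 0 by apply: contra_eq_neq uu' => ->; rewrite mulr0 eq_sym oner_neq0.
have n1 := norm_ge1 embP uK uA u0; have n1' := norm_ge1 embP u'K u'A u'0.
have n11 : \prod_i `|iota (e i u)| * \prod_i `|iota (e i u')| = 1.
  rewrite -big_split /= big1 // => i _.
  by rewrite -normrM -!rmorphM uu' !rmorph1 normr1.
apply/eqP; rewrite eq_le n1 andbT -[leRHS]n11 ler_peMr //.
by rewrite (le_trans ler01).
Qed.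

Definition tab4 (T : Type) (i0 i1 i2 : 'I_4) (a b c d : T) (i : 'I_4) :=
  if i == i0 then a else if i == i1 then b else if i == i2 then c else d.

Lemma tab4E (T : Type) i0 i1 i2 i3 (a b c d : T) : uniq [:: i0; i1; i2; i3] ->
  [/\ tab4 i0 i1 i2 a b c d i0 = a, tab4 i0 i1 i2 a b c d i1 = b,
      tab4 i0 i1 i2 a b c d i2 = c & tab4 i0 i1 i2 a b c d i3 = d].
Proof.
rewrite /= !inE !negb_or -!andbA andbT => /and4P[n01 n02 n03 /and3P[n12 n13 n23]].
rewrite /tab4 !eqxx !(eq_sym _ i0) (negbTE n01) (negbTE n02) (negbTE n03).
rewrite (eq_sym i2 i1) (eq_sym i3 i1) (negbTE n12) (negbTE n13).
by rewrite (eq_sym i3 i2) (negbTE n23).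
Qed.

Lemma ord4_mem i0 i1 i2 i3 (k : 'I_4) : uniq [:: i0; i1; i2; i3] -> k \in [:: i0; i1; i2; i3].
Proof. by move=> /ord4_perm us; rewrite -(perm_mem us) mem_index_enum. Qed.

Lemma big_ord4 (R : Type) (idx : R) (op : Monoid.com_law idx) i0 i1 i2 i3 (F : 'I_4 -> R) :
  uniq [:: i0; i1; i2; i3] ->
  \big[op/idx]_i F i = op (F i0) (op (F i1) (op (F i2) (F i3))).
Proof.
by move=> us; rewrite (perm_big _ (ord4_perm us)) /= !big_cons big_nil Monoid.mulm1.
Qed.

(** When all pairs are conjugate, the weights 5, 1, -2, -4 give M(v0) = v0 v1 and
    M(v0 v1) = v0 v1 * v0 v2 * v0 v3 = v0^2 up to sign, as the norm of v0 is a sign.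
    The factor ten in the weights makes the error terms harmless. *)
Lemma wandering_complete i0 i1 i2 i3 : uniq [:: i0; i1; i2; i3] ->
  (forall x y, x != y -> edge i0 i1 x y) ->
  exists x, algebraic_unit iota K x /\ wandering (iota x).
Proof.
move=> us complete; have := us; rewrite /= !inE !negb_or -!andbA andbT.
case/and4P=> n01 n02 n03 /and3P[n12 n13 n23].
pose w := tab4 i0 i1 i2 (50 : int) 10 (- 20) (- 40).
have [w0 w1 w2 w3] := @tab4E int i0 i1 i2 i3 50 10 (- 20) (- 40) us.
have [|u [u' [t [[uK u'K uA u'A] [uu' t1 sz]]]]] := exists_unit dimK realK embP (w := w).
  by rewrite (big_ord4 _ _ us) /w w0 w1 w2 w3.
have s0 : near iota t (e i0 u) 50 1 by rewrite -w0; exact: sz.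
have s1 : near iota t (e i1 u) 10 1 by rewrite -w1; exact: sz.
have s2 : near iota t (e i2 u) (- 20) 1 by rewrite -w2; exact: sz.
have s3 : near iota t (e i3 u) (- 40) 1 by rewrite -w3; exact: sz.
have := norm_unit uK u'K uA u'A uu'; rewrite (big_ord4 _ _ us) /=.
have u0 : u != 0 by apply: contra_eq_neq uu' => ->; rewrite mul0r eq_sym oner_neq0.
pose v i := e i u.
rewrite -![e _ u]/(v _) in s0 s1 s2 s3 *; move=> n1.
have eA i : iota (v i) \in Aint by exact: (emb_Aint embP).
have eR i : iota (v i) \is Num.real by exact: (emb_real iota realK (emb_gal embP i) uK).
have [p1 S1] : perm_eq (conjs (v i0)) [:: v i0; v i1; v i2; v i3] /\ distinct_abs (v i0).
  apply: sorted_conjs; first exact: (conjs_vertex (emb_act uK) i0 (fun k => ord4_mem k us)).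
  by rewrite /= (near_lt t1 s1 s0) // (near_lt t1 s2 s1) // (near_lt t1 s3 s2).
have m01 := near_mul t1 s0 s1; have m02 := near_mul t1 s0 s2.
have m03 := near_mul t1 s0 s3; have m12 := near_mul t1 s1 s2.
have m13 := near_mul t1 s1 s3; have m23 := near_mul t1 s2 s3.
have [p2 S2] : perm_eq (conjs (v i0 * v i1)) [:: v i0 * v i1; v i0 * v i2; v i0 * v i3;
    v i1 * v i2; v i1 * v i3; v i2 * v i3] /\ distinct_abs (v i0 * v i1).
  apply: sorted_conjs => [y|]; last first.
    rewrite /= (near_lt t1 m02 m01) // (near_lt t1 m03 m02) // (near_lt t1 m12 m03) //.
    by rewrite (near_lt t1 m13 m12) // (near_lt t1 m23 m13).
  rewrite (conjs_pair (emb_act uK)); split=> [[a [b [ab ->]]]|].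
    have nab : a != b by apply: contraTneq ab => ->; rewrite (edge_irrefl embP).
    move: nab; have := ord4_mem a us; have := ord4_mem b us; rewrite !inE.
    case/or4P => /eqP -> /or4P[] /eqP ->; rewrite ?eqxx ?orbT //= => _;
      by rewrite [e _ u * _]mulrC ?eqxx ?orbT.
  case/predU1P=> [->|]; first by exists i0, i1; rewrite complete.
  case/predU1P=> [->|]; first by exists i0, i2; rewrite complete.
  case/predU1P=> [->|]; first by exists i0, i3; rewrite complete.
  case/predU1P=> [->|]; first by exists i1, i2; rewrite complete.
  case/predU1P=> [->|]; first by exists i1, i3; rewrite complete.
  by case/predU1P=> [->|//]; exists i2, i3; rewrite complete.
have gt v' p r : near iota t v' p r -> 0 < p - r -> Num.max 1 `|iota v'| = `|iota v'|.
  by move=> nv pr; rewrite max1_gt // (near_gt1 t1 nv).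
have lt v' p r : near iota t v' p r -> p + r < 0 -> Num.max 1 `|iota v'| = 1.
  by move=> nv pr; rewrite max1_lt // (near_lt1 t1 nv).
apply: (wandering_unit_of (emb_act uK) eR eA (i := i0) (j := i1)) => //.
- by rewrite fmorph_eq0.
- by rewrite -fmorphV -[u^-1]mulr1 -uu' mulKf // (emb_Aint embP).
- rewrite (mahler_Aint_prod _ p1) // !big_cons big_nil (gt _ _ _ s0) // (gt _ _ _ s1) //.
  by rewrite (lt _ _ _ s2) // (lt _ _ _ s3) // !mulr1 rmorphM normrM.
- have bA : iota (v i0 * v i1) \in Aint by rewrite rmorphM rpredM.
  rewrite (mahler_Aint_prod bA p2) !big_cons big_nil.
  rewrite (gt _ _ _ m01) // (gt _ _ _ m02) // (gt _ _ _ m03) // (lt _ _ _ m12) //.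
  rewrite (lt _ _ _ m13) // (lt _ _ _ m23) // !mulr1 !rmorphM !normrM.
  by rewrite -[RHS]mulr1 -n1; ring.
- exact: (near_gt1 t1 m01).
Qed.

(** When the conjugate pairs form a 4-cycle, K has a quadratic subfield and opposite
    embeddings, i and opp i below, agree on it. Dividing each conjugate of a unit by
    the opposite one gives v with v2 = 1/v0 and v3 = 1/v1, so that M(v0) = v0 v1 and
    M(v0 v1) = v0 v1 * v0 v3 = v0^2 up to sign. The weights 2, 1, -2, -1 of the unit
    make v0, v1, v0 v1 and v0 v3 large and their inverses small. *)
Lemma wandering_cycle i0 i1 i2 i3 : uniq [:: i0; i1; i2; i3] ->
  edge i0 i1 i0 i1 -> edge i0 i1 i1 i2 -> edge i0 i1 i2 i3 -> edge i0 i1 i3 i0 ->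
  ~~ edge i0 i1 i0 i2 -> ~~ edge i0 i1 i1 i3 ->
  exists x, algebraic_unit iota K x /\ wandering (iota x).
Proof.
move=> us E01 E12 E23 E30 /negbTE nE02 /negbTE nE13.
have := us; rewrite /= !inE !negb_or -!andbA andbT.
case/and4P=> n01 n02 n03 /and3P[n12 n13 n23].
have sE := edge_sym theta e i0 i1.
have nE20 : edge i0 i1 i2 i0 = false by rewrite sE.
have nE31 : edge i0 i1 i3 i1 = false by rewrite sE.
pose opp := tab4 i0 i1 i2 i2 i3 i0 i1.
have [o0 o1 o2 o3] := tab4E i2 i3 i0 i1 us; rewrite -/opp in o0 o1 o2 o3.
have opp_uniq i j : i != j -> ~~ edge i0 i1 i j -> j = opp i.
  have := ord4_mem i us; have := ord4_mem j us; rewrite !inE.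
  case/or4P => /eqP -> /or4P[] /eqP ->; rewrite ?eqxx // => _;
    by rewrite ?(E01, E12, E23, E30) // sE ?(E01, E12, E23, E30).
have opp_edge i : i != opp i /\ ~~ edge i0 i1 i (opp i).
  have := ord4_mem i us; rewrite !inE.
  case/or4P => /eqP ->; rewrite ?o0 ?o1 ?o2 ?o3 ?nE02 ?nE20 ?nE13 ?nE31 ?n02 ?n13 //.
    by rewrite eq_sym n02.
  by rewrite eq_sym n13.
have opp_act g i : g \in G -> gact g (opp i) = opp (gact g i).
  move=> gG; have [ne nE] := opp_edge i; apply: opp_uniq.
    by rewrite (inj_eq (gact_inj embP gG)).
  by rewrite (edge_act embP).
pose w := tab4 i0 i1 i2 (20 : int) 10 (- 20) (- 10).
have [w0 w1 w2 w3] := @tab4E int i0 i1 i2 i3 20 10 (- 20) (- 10) us.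
have [|u [u' [t [[uK u'K uA u'A] [uu' t1 sz]]]]] := exists_unit dimK realK embP (w := w).
  by rewrite (big_ord4 _ _ us) /w w0 w1 w2 w3.
have u0 : u != 0 by apply: contra_eq_neq uu' => ->; rewrite mul0r eq_sym oner_neq0.
have Du' : u^-1 = u' by rewrite -[u^-1]mulr1 -uu' mulKf.
have eu0 i : e i u != 0 by rewrite fmorph_eq0.
have s0 : near iota t (e i0 u) 20 1 by rewrite -w0; exact: sz.
have s1 : near iota t (e i1 u) 10 1 by rewrite -w1; exact: sz.
have s2 : near iota t (e i2 u) (- 20) 1 by rewrite -w2; exact: sz.
have s3 : near iota t (e i3 u) (- 10) 1 by rewrite -w3; exact: sz.
pose v i := e i u / e (opp i) u.
have v_act g : g \in G -> forall i, g (v i) = v (gact g i).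
  by move=> gG i; rewrite /v fmorph_div /= !(gact_emb embP) // opp_act.
have vA i : iota (v i) \in Aint.
  by rewrite /v -fmorphV Du' rmorphM rpredM ?(emb_Aint embP).
have eR i : iota (e i u) \is Num.real.
  by exact: (emb_real iota realK (emb_gal embP i) uK).
have vR i : iota (v i) \is Num.real by rewrite /v fmorph_div rpred_div.
have v2 : v i2 = (v i0)^-1 by rewrite /v o0 o2 invf_div.
have v3 : v i3 = (v i1)^-1 by rewrite /v o1 o3 invf_div.
have v00 i : v i != 0 by rewrite mulf_neq0 ?invr_eq0.
have r0 : near iota t (v i0) 40 2.
  by rewrite /v o0; exact: (near_mul t1 s0 (near_inv t1 (eu0 i2) s2)).
have r1 : near iota t (v i1) 20 2.
  by rewrite /v o1; exact: (near_mul t1 s1 (near_inv t1 (eu0 i3) s3)).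
have r2 : near iota t (v i2) (- 40) 2 by rewrite v2; exact: near_inv.
have r3 : near iota t (v i3) (- 20) 2 by rewrite v3; exact: near_inv.
have [p1 S1] : perm_eq (conjs (v i0)) [:: v i0; v i1; v i3; v i2] /\ distinct_abs (v i0).
  apply: sorted_conjs.
    apply: (conjs_vertex v_act i0 (s := [:: i0; i1; i3; i2])) => k.
    by have := ord4_mem k us; rewrite !inE => /or4P[] ->; rewrite ?orbT.
  by rewrite /= (near_lt t1 r1 r0) // (near_lt t1 r3 r1) // (near_lt t1 r2 r3).
have m01 := near_mul t1 r0 r1; have m30 := near_mul t1 r3 r0.
have m12 := near_mul t1 r1 r2; have m23 := near_mul t1 r2 r3.
have [p2 S2] : perm_eq (conjs (v i0 * v i1)) [:: v i0 * v i1; v i3 * v i0; v i1 * v i2;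
    v i2 * v i3] /\ distinct_abs (v i0 * v i1).
  apply: sorted_conjs => [y|]; last first.
    by rewrite /= (near_lt t1 m30 m01) // (near_lt t1 m12 m30) // (near_lt t1 m23 m12).
  rewrite (conjs_pair v_act); split=> [[a [b [ab ->]]]|].
    move: ab; have := ord4_mem a us; have := ord4_mem b us; rewrite !inE.
    case/or4P => /eqP -> /or4P[] /eqP ->;
      rewrite ?eqxx ?orbT // ?(nE02, nE20, nE13, nE31) // ?(edge_irrefl embP) // => _;
      rewrite ?(mulrC (v i1) (v i0)) ?(mulrC (v i0) (v i3)) ?(mulrC (v i2) (v i1));
      by rewrite ?(mulrC (v i3) (v i2)) !eqxx ?orbT.
  case/predU1P=> [->|]; first by exists i0, i1.
  case/predU1P=> [->|]; first by exists i3, i0.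
  case/predU1P=> [->|]; first by exists i1, i2.
  by case/predU1P=> [->|//]; exists i2, i3.
have gt v' p r : near iota t v' p r -> 0 < p - r -> Num.max 1 `|iota v'| = `|iota v'|.
  by move=> nv pr; rewrite max1_gt // (near_gt1 t1 nv).
have lt v' p r : near iota t v' p r -> p + r < 0 -> Num.max 1 `|iota v'| = 1.
  by move=> nv pr; rewrite max1_lt // (near_lt1 t1 nv).
apply: (wandering_unit_of v_act vR vA (i := i0) (j := i1)) => //.
- by rewrite -v2.
- rewrite (mahler_Aint_prod _ p1) // !big_cons big_nil (gt _ _ _ r0) // (gt _ _ _ r1) //.
  by rewrite (lt _ _ _ r2) // (lt _ _ _ r3) // !mulr1 rmorphM normrM.
- have bA : iota (v i0 * v i1) \in Aint by rewrite rmorphM rpredM.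
  rewrite (mahler_Aint_prod bA p2) !big_cons big_nil.
  rewrite (gt _ _ _ m01) // (gt _ _ _ m30) // (lt _ _ _ m12) // (lt _ _ _ m23) // !mulr1.
  rewrite -normrM -normrX -rmorphM -rmorphXn v3; congr (`|iota _|).
  by rewrite mulrA mulfK // expr2.
- exact: (near_gt1 t1 m01).
Qed.

Lemma wandering_unit_exists : ~ biquadratic K ->
  exists x, algebraic_unit iota K x /\ wandering (iota x).
Proof.
move=> nbi.
have [g gG [i [j nij split]]] : exists2 g, g \in G & exists i, exists2 j, i != j &
    (gact g i \in [:: i; j]) != (gact g j \in [:: i; j]).
  apply: contrapT => none; apply: nbi; apply: (unsplit_biquadratic dimK embP) => g gG i j nij.
  apply/eqP; apply: contraT => ne; exfalso; apply: none.
  by exists g => //; exists i, j.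
have Eij := edge_refl embP i j.
have Eg : edge i j (gact g i) (gact g j) by rewrite (edge_act embP).
have gij : gact g i != gact g j by rewrite (inj_eq (gact_inj embP gG)).
have [|i0 [i1 [i2 [i3 [us E01 cases]]]]]  :=
    regular_graph4 (edge_sym theta e i j) (fun x => edge_irrefl embP x nij)
      (edge_regular embP i j).
- have sE := edge_sym theta e i j.
  move: split Eg gij; rewrite !inE.
  have [->|n1] := eqVneq (gact g i) i.
    rewrite /= negb_or => /andP[_ nj] Eg _; exists i, j, (gact g j).
    by rewrite eq_sym.
  have [->|n2] := eqVneq (gact g i) j.
    rewrite /= negb_or => /andP[ni _] Eg _; exists j, i, (gact g j).
    by rewrite eq_sym sE.
  have [->|_] := eqVneq (gact g j) i => [_ Eg _|].
    by exists i, j, (gact g i); rewrite eq_sym n2 Eij sE Eg.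
  have [->|//] := eqVneq (gact g j) j => _ Eg _.
  by exists j, i, (gact g i); rewrite eq_sym n1 sE Eij sE Eg.
have EB := edge_base embP _ _ E01.
case: cases => [complete|[_ E12 E23 E30 [n02 n13]]].
  by apply: (wandering_complete us) => x y nxy; rewrite EB complete.
by apply: (wandering_cycle us); rewrite EB.
Qed.

End NonBiquadratic.

Theorem proposition3p6 (L : splittingFieldType rat)
    (iota : {rmorphism L -> algC}) (K : {subfield L})
    (dimK : \dim K = 4%N) (realK : totally_real K) :
  ((forall x : L, x \in K -> preperiodic (iota x)) <-> biquadratic K) /\
  (~ biquadratic K ->
     exists u : L, algebraic_unit iota K u /\ wandering (iota u)).
Proof.
have [theta [e embP]] := exists_embeddings iota dimK.
have wand := wandering_unit_exists dimK realK embP.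
split=> //; split=> [prep|]; last exact: biquadratic_preperiodic.
apply: contrapT => /wand[u [[uK _ _] wu]].
exact: wu (prep u uK).
Qed.
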